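(* Let $n\geq 2$ be an integer. Suppose that every ideal minimally non-packing clutter with fewer than $(n-1)^2/4$ elements has covering number $2$ (i.e., the $\tau=2$ conjecture is true for all clutters with fewer than $(n-1)^2/4$ elements). Then every clutter with at most $n$ elements that has the packing property is MFMC (i.e., the replication conjecture holds for all clutters with at most $n$ elements).
   Context: A clutter $\mathcal{C}$ over a finite ground set $E$ of elements is a family of subsets of $E$, none of which is contained in another; the number of elements of $\mathcal{C}$ means $|E|$. A cover of $\mathcal{C}$ is a subset of $E$ that intersects every member of $\mathcal{C}$. For $w\in \mathbb{Z}^E_{\ge 0}$, $\tau(\mathcal{C},w)$ is the minimum of $\sum_{e\in B}w_e$ over all covers $B$ of $\mathcal{C}$, and $\nu(\mathcal{C},w)$ is the maximum of $\sum_{C\in\mathcal{C}}y_C$ over all $y\in\mathbb{Z}^{\mathcal{C}}_{\ge 0}$ with $\sum_{C\ni e}y_C\le w_e$ for all $e\in E$. Convention: for the trivial clutter $\{\emptyset\}$, $\tau=\nu=+\infty$, and this clutter is considered ideal. The covering number is $\tau(\mathcal{C},\mathbf{1})$. $\mathcal{C}$ packs if $\tau(\mathcal{C},\mathbf{1})=\nu(\mathcal{C},\mathbf{1})$. $\mathcal{C}$ is MFMC if $\tau(\mathcal{C},w)=\nu(\mathcal{C},w)$ for all $w\in \mathbb{Z}^E_{\geq 0}$. $\mathcal{C}$ is ideal if the linear program $\min\{w^\top x: \sum_{e\in C}x_e\ge 1\ \forall C\in\mathcal{C},\ x\ge \mathbf{0}\}$ has an integral optimal solution for every $w\in\mathbb{Z}^E_{\ge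 0}$. For disjoint $I,J\subseteq E$, the minor $\mathcal{C}\setminus I/J$ is the clutter over ground set $E\setminus(I\cup J)$ whose sets are the inclusion-wise minimal sets in $\{C\setminus J: C\in\mathcal{C},\ C\cap I=\emptyset\}$; it is proper if $I\cup J\neq\emptyset$. $\mathcal{C}$ has the packing property if every minor of it (including itself) packs. $\mathcal{C}$ is minimally non-packing if it does not pack but every proper minor of it packs. *)

(* Defs.v *)
From mathcomp Require Import all_boot all_order all_algebra.
From mathcomp Require Import boolp reals.

Set Implicit Arguments.
Unset Strict Implicit.
Unset Printing Implicit Defensive.

(* The ground set is a subset of a finite type, so that all minors of a clutter
   live over the same type. Elements of T outside the ground set play no role. *)
Record clutter (T : finType) := Clutter {
  ground : {set T};
  members : {set {set T}};
  members_sub : forall C, C \in members -> C \subset ground;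
  members_antichain : forall C D,
    C \in members -> D \in members -> C \subset D -> C = D
}.

(* None stands for +oo: the minimum of the empty set of naturals and the
   maximum of an unbounded one. *)
Definition minimum (A : nat -> Prop) : option nat :=
  if pselect (exists m, A m /\ forall k, A k -> m <= k) is left h
  then Some (sval (cid h)) else None.

Definition maximum (A : nat -> Prop) : option nat :=
  if pselect (exists m, A m /\ forall k, A k -> k <= m) is left h
  then Some (sval (cid h)) else None.

Section Clutters.

Variable T : finType.
Implicit Types (C : clutter T) (w : T -> nat) (B I J : {set T}).

Definition is_cover C B : Prop :=
  B \subset ground C /\ forall D, D \in members C -> B :&: D != set0.

Definition is_packing C w (y : {set T} -> nat) : Prop :=
  forall e, e \in ground C -> \sum_(D in members C | e \in D) y D <= w e.

(* For the trivial clutter {set0} both tau and nu are None: it has no cover,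
   and its packings have unbounded value. Every other clutter has finite tau
   and nu. *)
Definition tau C w : option nat :=
  minimum (fun k => exists2 B, is_cover C B & k = \sum_(e in B) w e).

Definition nu C w : option nat :=
  maximum (fun k => exists2 y, is_packing C w y & k = \sum_(D in members C) y D).

Definition covering_number C : option nat := tau C (fun=> 1).

Definition packs C : Prop := tau C (fun=> 1) = nu C (fun=> 1).

Definition MFMC C : Prop := forall w, tau C w = nu C w.

Definition minor_family C I J : {set {set T}} :=
  [set D :\: J | D in members C & [disjoint D & I]].

Definition minor_members C I J : {set {set T}} :=
  [set D | minset [in minor_family C I J] D].

Lemma minor_members_sub C I J D :
  D \in minor_members C I J -> D \subset ground C :\: (I :|: J).
Proof.
rewrite inE => /minsetP [/imsetP [D']]; rewrite inE => /andP [CD' dI] -> _.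
apply/subsetP=> e; rewrite !inE => /andP [/negPf eJ eD'].
by rewrite eJ orbF (subsetP (members_sub CD')) // (disjointFr dI eD').
Qed.

Lemma minor_members_antichain C I J D D' :
  D \in minor_members C I J -> D' \in minor_members C I J ->
  D \subset D' -> D = D'.
Proof.
rewrite !inE => /minsetP [FD _] /minsetP [_ minD'] sDD'.
exact: minD' FD sDD'.
Qed.

(* I is deleted and J is contracted. *)
Definition minor C I J : clutter T :=
  Clutter (@minor_members_sub C I J) (@minor_members_antichain C I J).

Definition minor_sets C I J : Prop :=
  [/\ I \subset ground C, J \subset ground C & [disjoint I & J]].

Definition packing_property C : Prop :=
  forall I J, minor_sets C I J -> packs (minor C I J).

Definition minimally_nonpacking C : Prop :=
  ~ packs C /\
  forall I J, minor_sets C I J -> I :|: J != set0 -> packs (minor C I J).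

Local Open Scope ring_scope.

Definition lp_feasible (R : realType) C (x : T -> R) : Prop :=
  (forall D, D \in members C -> 1 <= \sum_(e in D) x e) /\
  (forall e, e \in ground C -> 0 <= x e).

Definition lp_value (R : realType) C w (x : T -> R) : R :=
  \sum_(e in ground C) (w e)%:R * x e.

Definition lp_optimal (R : realType) C w (x : T -> R) : Prop :=
  lp_feasible C x /\
  forall x' : T -> R, lp_feasible C x' -> lp_value C w x <= lp_value C w x'.

(* The trivial clutter is ideal by convention, its linear program being
   infeasible. *)
Definition ideal (R : realType) C : Prop :=
  members C = [set set0] \/
  forall w, exists2 x : T -> R, lp_optimal C w x &
    forall e, e \in ground C -> x e \is a Num.int.

End Clutters.

(* Main.v *)
Require Import Defs.
From mathcomp Require Import all_boot all_order all_algebra.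
From mathcomp Require Import reals.
From mathcomp Require Import boolp zify ring lra.

(** Call a clutter balanced at a weight [w] when [tau = nu] there. Consider a
    clutter [C] with the packing property that is not MFMC and whose ground set
    [E] is as small as possible, so that its proper minors are MFMC, and a
    weight [w] of smallest total at which [C] is not balanced. Let [n = #|E|].

    [C] is ideal. Weak duality shows that an MFMC clutter is [roundable]: no
    fractional cover is cheaper than all covers. If [C] were not roundable, a
    fractional cover cheaper than all covers could be moved to a vertex [x]. As
    contractions of [C] are roundable, [x] is positive, so it is determined by
    [n] independent tight members. Rounding [x] in deletions of [C]
    ([transversal_cover]) and comparing ranks shows that a tight member [A] of
    this basis missing [e] has at most as many elements as there are members of
    the basis through [e]. A double count in the style of de Bruijn and Erdos
    then gives positive weights on the basis with equal load on all elements,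
    and these show that covers have more elements than any packing has members:
    [C] would not pack ([roundable_of_minors]).

    The total [W] of [w] is small ([gap_weight_bound]). Linear programming
    duality gives a fractional packing [y] of value [tau]; take its support, of
    size [k], independent. By minimality of [w], every element is in a minimum
    cover and [y] is smaller than 1 everywhere. Complementary slackness makes
    every minimum cover [B] meet every support member exactly once, and counting
    the support along [B] gives [tau + #|B| <= k]. If [r] is the rank of the
    minimum covers, then [k + r <= n + 1]. A basis of [r] minimum covers covers
    [E], so [W + n <= r * k], and [W + 2 * r <= r * k] since no cover has fewer
    than two elements. These inequalities imply [4 * W < (n - 1) ^ 2].

    Finally, replace every element [e] by [w e] copies. The resulting clutter has
    [W] elements, is ideal like [C], does not pack, and its proper minors
    pack, because they behave like replications of proper minors of [C], or of
    [C] with a smaller weight. By hypothesis it has a cover with two elements, so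
    [tau <= 2] for [C] and [w]. Since [C] itself packs, [w e >= 2] for some [e],
    and the minimum cover through [e] can only be [[set e]]. But an element that
    is in all members can be contracted ([balanced_singleton]), and the
    contraction is MFMC. *)

Set Implicit Arguments.
Unset Strict Implicit.
Unset Printing Implicit Defensive.

Import Order.TTheory GRing.Theory Num.Theory.

(** * Weighted covers and packings *)

Section Extrema.

Implicit Types (A : nat -> Prop) (m : nat).

Lemma minimum_eq A m : A m -> (forall k, A k -> m <= k) -> minimum A = Some m.
Proof.
move=> Am minm; rewrite /minimum; case: pselect => [h|[]]; last by exists m.
case: cid => m' [Am' minm'] /=; congr Some.
by apply/eqP; rewrite eqn_leq minm' ?minm.
Qed.

Lemma minimum_none A : (forall k, ~ A k) -> minimum A = None.
Proof.
move=> nA; rewrite /minimum; case: pselect => // h.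
by exfalso; case: h => m [/nA].
Qed.

Lemma minimum_in A m : minimum A = Some m -> A m.
Proof. by rewrite /minimum; case: pselect => // h [<-]; case: cid => ? []. Qed.

Lemma maximum_eq A m : A m -> (forall k, A k -> k <= m) -> maximum A = Some m.
Proof.
move=> Am maxm; rewrite /maximum; case: pselect => [h|[]]; last by exists m.
case: cid => m' [Am' maxm'] /=; congr Some.
by apply/eqP; rewrite eqn_leq maxm' ?maxm.
Qed.

Lemma maximum_none A : (forall k, A k) -> maximum A = None.
Proof.
move=> allA; rewrite /maximum; case: pselect => // h; exfalso; case: h => m [_ maxm].
by have := maxm m.+1 (allA _); rewrite ltnn.
Qed.

Lemma maximum_in A m : maximum A = Some m -> A m.
Proof. by rewrite /maximum; case: pselect => // h [<-]; case: cid => ? []. Qed.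

End Extrema.

Section Duality.

Variable T : finType.
Implicit Types (C : clutter T) (w : T -> nat) (A B D I J : {set T}).
Implicit Types (s : seq {set T}).

(** The number of listed sets through [e], with repetition. Integral packings
    are handled as lists of members, repetition standing for multiplicity:
    truncating, extending or mapping a packing is then a list operation. *)
Definition load s e := count (fun D : {set T} => e \in D) s.

Definition packing_list C w s : Prop :=
  {subset s <= members C} /\ forall e, e \in ground C -> load s e <= w e.

Lemma sum_count_mem (P : pred {set T}) (M : {set {set T}}) s :
  {subset s <= M} -> \sum_(D in M | P D) count_mem D s = count P s.
Proof.
elim: s => [|D s IHs] sM; first by rewrite big1.
have MD : D \in M by apply: sM; rewrite mem_head.
rewrite /= -IHs => [|A As]; last by apply: sM; rewrite inE As orbT.
rewrite big_split /=; congr (_ + _).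
rewrite big_mkcond (bigD1 D) //= MD eqxx /= big1 ?addn0; first by case: (P D).
by move=> A; rewrite eq_sym => /negPf ->; rewrite if_same.
Qed.

Lemma is_packing_count C w s : packing_list C w s ->
  is_packing C w (fun D => count_mem D s) /\
  \sum_(D in members C) count_mem D s = size s.
Proof.
case=> sC ws; split=> [e /ws|]; first by rewrite sum_count_mem.
rewrite -[RHS]count_predT -(sum_count_mem _ sC).
by apply: eq_bigl => D; rewrite andbT.
Qed.

Lemma packing_list_of C w y : is_packing C w y ->
  exists2 s, packing_list C w s & size s = \sum_(D in members C) y D.
Proof.
move=> wy; pose s := flatten [seq nseq (y D) D | D <- enum (members C)].
have count_s P : count P s = \sum_(D in members C | P D) y D.
  rewrite count_flatten sumnE !big_map big_mkcondr big_enum /=.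
  by apply: eq_bigr => D _; rewrite count_nseq; case: (P D); rewrite ?mul1n.
exists s; last first.
  by rewrite -count_predT count_s; apply: eq_bigl => D; rewrite andbT.
split=> [D /flattenP [_ /mapP [D' CD' ->]]|e /wy]; last by rewrite /load count_s.
by rewrite mem_nseq => /andP [_ /eqP ->]; rewrite mem_enum in CD'.
Qed.

Lemma sum_load B s : \sum_(e in B) load s e = \sum_(D <- s) #|B :&: D|.
Proof.
elim: s => [|D s IHs]; first by rewrite big_nil big1.
rewrite big_cons -IHs big_split /=; congr (_ + _).
rewrite -sum1_card big_mkcond [RHS]big_mkcond /=; apply: eq_bigr => e _.
by rewrite inE; case: (e \in B); case: (e \in D).
Qed.

Lemma weak_duality C w B s :
  is_cover C B -> packing_list C w s -> size s <= \sum_(e in B) w e.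
Proof.
move=> [BC covB] [sC ws]; apply: (@leq_trans (\sum_(e in B) load s e)); last first.
  by apply: leq_sum => e /(subsetP BC) /ws.
rewrite sum_load -sum1_size big_seq [leqRHS]big_seq.
by apply: leq_sum => D /sC /covB; rewrite card_gt0.
Qed.

(** The form in which [tau C w = nu C w] is used: by weak duality, a cover and a
    packing with the inequality that weak duality does not give are both optimal. The
    first disjunct is the trivial clutter, where both values are infinite. *)
Definition balanced C w : Prop :=
  set0 \in members C \/
  exists B s, [/\ is_cover C B, packing_list C w s
                & \sum_(e in B) w e <= size s].

Lemma cover_ground C : set0 \notin members C -> is_cover C (ground C).
Proof.
move=> C0; split=> // D CD; rewrite (setIidPr (members_sub CD)).
by apply: contraNneq C0 => <-.
Qed.

Lemma min_cover_exists C w : set0 \notin members C ->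
  exists2 B, is_cover C B &
    forall B', is_cover C B' -> \sum_(e in B) w e <= \sum_(e in B') w e.
Proof.
move=> /cover_ground /asboolP cE; pose P B := `[< is_cover C B >].
have [B /asboolP cB minB] := arg_minnP (fun B => \sum_(e in B) w e) (cE : P _).
by exists B => // B' /asboolP; apply: minB.
Qed.

Lemma tau_eq_nuP C w : tau C w = nu C w <-> balanced C w.
Proof.
split=> [tau_nu | [C0 | [B [s [cB ws wBs]]]]].
- have [C0|C0] := boolP (set0 \in members C); [by left | right].
  have [B cB minB] := min_cover_exists w C0.
  move: tau_nu; rewrite /tau (@minimum_eq _ (\sum_(e in B) w e)); first last.
  + by move=> k [B' cB' ->]; apply: minB.
  + by exists B.
  move/esym/maximum_in => [y /packing_list_of [s ws <-] eq_s].
  by exists B, s; rewrite eq_s.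
- rewrite /tau /nu minimum_none => [|k [B [_ cB] _]]; last first.
    by have := cB _ C0; rewrite setI0 eqxx.
  rewrite maximum_none // => m.
  have ws: packing_list C w (nseq m set0).
    split=> [D|e _]; first by rewrite mem_nseq => /andP [_ /eqP ->].
    by rewrite /load count_nseq inE mul0n.
  by have [] := is_packing_count ws; rewrite size_nseq; eexists; eauto.
- rewrite /tau /nu (@minimum_eq _ (\sum_(e in B) w e)).
  + apply/esym/maximum_eq.
    * have [wy sy] := is_packing_count ws; exists (fun D => count_mem D s) => //.
      by rewrite sy; apply/eqP; rewrite eqn_leq wBs (weak_duality cB ws).
    * move=> k [y /packing_list_of [s' ws' <-] ->].
      exact: weak_duality cB ws'.
  + by exists B.
  by move=> k [B' cB' ->]; apply: leq_trans wBs (weak_duality cB' ws).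
Qed.

Lemma balanced_ext C C' w w' : ground C = ground C' -> members C = members C' ->
  {in ground C, w =1 w'} -> balanced C w -> balanced C' w'.
Proof.
move=> EC MC eqw [C0|[B [s [[BC cB] [sC ws] wBs]]]]; [left|right].
  by rewrite -MC.
exists B, s; split; rewrite /is_cover /packing_list -?EC -?MC //.
  by split=> // e Ce; rewrite -eqw ?ws.
apply: leq_trans wBs; rewrite leq_eqVlt; apply/orP; left; apply/eqP/eq_bigr.
by move=> e /(subsetP BC) /eqw.
Qed.

End Duality.

(** * Minors *)

Section Minors.

Variable T : finType.
Implicit Types (C : clutter T) (w : T -> nat) (A B D I J : {set T}).
Implicit Types (s : seq {set T}).

(** Together with [minor_shrink], this allows minors to be handled without the
    minimality clause of their definition: members of a minor come from members
    of [C], and conversely a member of [C] avoiding [I] contains, outside [J], a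
    member of the minor. *)
Lemma minor_lift C I J D : D \in members (minor C I J) ->
  exists D', [/\ D' \in members C, [disjoint D' & I] & D = D' :\: J].
Proof.
rewrite inE => /minsetP [/imsetP [D']]; rewrite inE => /andP [CD' dI] -> _.
by exists D'.
Qed.

Lemma minor_shrink C I J D : D \in members C -> [disjoint D & I] ->
  exists2 D', D' \in members (minor C I J) & D' \subset D :\: J.
Proof.
move=> CD dI; have FD : D :\: J \in minor_family C I J.
  by apply: imset_f; rewrite inE CD.
have [D' minD' sD'] := minset_exists (P := [in minor_family C I J]) FD.
by exists D'; rewrite // inE.
Qed.

Lemma is_cover_minor C I J B : is_cover (minor C I J) B <->
  B \subset ground C :\: (I :|: J) /\
  forall D, D \in members C -> [disjoint D & I] -> B :&: D != set0.
Proof.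
split=> [[BC cB]|[BC cB]]; split=> // D.
  move=> CD /(minor_shrink J CD) [D' /cB BD' sD'].
  apply: contraNneq BD' => BD; rewrite -subset0 -BD setIS //.
  exact: subset_trans sD' (subsetDl _ _).
move=> /minor_lift [D' [CD' dI ->]]; have := cB _ CD' dI.
have -> // : B :&: (D' :\: J) = B :&: D'.
rewrite setIDA; apply/setDidPl; rewrite disjoints_subset.
apply: subset_trans (subsetIl _ _) (subset_trans BC _).
by apply/subsetP=> e; rewrite !inE negb_or => /andP [/andP [_ ->]].
Qed.

Lemma minor_minor C I J I' J' : [disjoint J & I'] ->
  ground (minor (minor C I J) I' J') = ground (minor C (I :|: I') (J :|: J')) /\
  members (minor (minor C I J) I' J') = members (minor C (I :|: I') (J :|: J')).
Proof.
move=> dJ; split; first by rewrite /= setDDl; congr (_ :\: _); rewrite setUACA.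
set C1 := minor C I J; set C2 := minor C _ _.
have lift D : D \in minor_family C1 I' J' ->
    D \in minor_family C (I :|: I') (J :|: J').
  case/imsetP=> D1; rewrite inE => /andP [/minor_lift [D2 [CD2 dI ->]] dI'] ->.
  rewrite setDDl; apply: imset_f; rewrite inE CD2 /=.
  rewrite -setI_eq0 setIUr setU_eq0 setI_eq0 dI /=.
  rewrite -setI_eq0 setIDAC setD_eq0 in dI'.
  rewrite -subset0 -(eqP (_ : J :&: I' == set0)) ?setI_eq0 //.
  by rewrite subsetI dI' subsetIr.
have shrink D : D \in minor_family C (I :|: I') (J :|: J') ->
    exists2 D', D' \in minor_family C1 I' J' & D' \subset D.
  case/imsetP=> D1; rewrite inE => /andP [CD1].
    rewrite -setI_eq0 setIUr setU_eq0 !setI_eq0 => /andP [dI dI'] ->.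
    have [D2 C1D2 sD2] := minor_shrink J CD1 dI.
    exists (D2 :\: J'); last by rewrite -setDDl setSD.
    apply: imset_f; rewrite inE C1D2 /= (disjointWl sD2) //.
    exact: disjointWl (subsetDl _ _) dI'.
apply/setP=> D; rewrite !inE; apply/minsetP/minsetP=> -[FD minD]; split.
- exact: lift.
- move=> A FA sA; have [A' FA' sA'] := shrink _ FA.
  apply/eqP; rewrite eqEsubset sA -(minD _ FA') //.
  exact: subset_trans sA' sA.
- by have [D' FD' sD'] := shrink _ FD; rewrite -(minD _ (lift _ FD') sD').
- by move=> A /lift; apply: minD.
Qed.

Lemma minor_packing_property C I J : minor_sets C I J ->
  packing_property C -> packing_property (minor C I J).
Proof.
move=> [IC JC dIJ] ppC I' J' [/= /subsetDP [I'C dI'] /subsetDP [J'C dJ'] dI'J'].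
have dJI' : [disjoint J & I'].
  by rewrite disjoint_sym; apply: disjointWr dI'; apply: subsetUr.
have [Eq1 Eq2] := minor_minor C I J' dJI'.
apply/tau_eq_nuP; apply: balanced_ext (esym Eq1) (esym Eq2) _ _ => [e _|]; first by [].
apply/tau_eq_nuP/ppC; split; rewrite ?subUset ?IC ?JC //.
move: dIJ dI' dJ' dI'J'; rewrite -!setI_eq0 !setIUr !setIUl !setU_eq0.
by move=> -> /andP [_ ->] /andP [+ _] ->; rewrite setIC => ->.
Qed.

End Minors.

(** * Linear independence of families of sets *)

Section Independence.

Variables (F : fieldType) (T : finType) (E : {set T}).
Implicit Types (P Q : {set {set T}}) (A B D : {set T}).
Local Open Scope ring_scope.

(** Linear independence over [F] of the incidence vectors, on [E], of the sets
    in [P]. *)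
Definition indep P : Prop :=
  forall c : {set T} -> F,
    (forall e, e \in E -> \sum_(D in P | e \in D) c D = 0) ->
    forall D, D \in P -> c D = 0.

Lemma dependentP P : ~ indep P ->
  exists2 c : {set T} -> F,
    forall e, e \in E -> \sum_(D in P | e \in D) c D = 0 &
    exists2 D, D \in P & c D != 0.
Proof.
move=> ndP; apply: contrapT => ndP'; apply: ndP => c c0 D PD.
by apply/eqP; apply: contraPT isT => cD _; apply: ndP'; exists c; last by exists D.
Qed.

(** A row vector indexed by the enumeration of [X], read as a function on the
    ambient type. *)
Definition extend_row (I : finType) (X : {set I}) (v : 'rV[F]_#|X|) (x : I) : F :=
  \sum_(j < #|X| | enum_val j == x) v 0 j.

Lemma extend_row_enum (I : finType) (X : {set I}) (v : 'rV[F]_#|X|) k :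
  extend_row v (enum_val k) = v 0 k.
Proof.
by rewrite /extend_row (big_pred1 k) // => j; rewrite (inj_eq enum_val_inj).
Qed.

Definition incidence P : 'M[F]_(#|P|, #|E|) :=
  \matrix_(i, j) (enum_val j \in (enum_val i : {set T}))%:R.

Lemma sum_incidence (I : finType) (X : {set I}) (a : pred I) (f : I -> F) :
  \sum_(j < #|X|) f (enum_val j) * (a (enum_val j))%:R
  = \sum_(x in X | a x) f x.
Proof.
rewrite -(big_enum_val (fun x => f x * (a x)%:R)) big_mkcondr /=.
by apply: eq_bigr => x _; case: (a x); rewrite ?mulr1 ?mulr0.
Qed.

Lemma indep_row_free P : indep P -> row_free (incidence P).
Proof.
move=> indP; rewrite -kermx_eq0; apply/rowV0P => v /sub_kermxP vP0.
apply/rowP => i; rewrite mxE -extend_row_enum.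
apply: indP (enum_valP i) => e Ee.
rewrite -(enum_rankK_in Ee Ee) -sum_incidence.
move/rowP/(_ (enum_rank_in Ee e)): vP0; rewrite !mxE => {2}<-.
by apply: eq_bigr => j _; rewrite extend_row_enum mxE.
Qed.

Lemma nonzero_orthogonal P : (#|P| < #|E|)%N ->
  exists2 d : T -> F, forall D, D \in P -> \sum_(e in E | e \in D) d e = 0 &
    exists2 e, e \in E & d e != 0.
Proof.
move=> ltPE; have: kermx (incidence P)^T != 0.
  rewrite kermx_eq0 /row_free neq_ltn (leq_ltn_trans _ ltPE) //.
  exact: rank_leq_col.
case/rowV0Pn=> v /sub_kermxP vP0 vn0; exists (extend_row v) => [D PD|].
  rewrite -(enum_rankK_in PD PD) -(sum_incidence E (fun e => e \in _)).
  move/rowP/(_ (enum_rank_in PD D)): vP0; rewrite !mxE => {2}<-.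
  by apply: eq_bigr => j _; rewrite extend_row_enum !mxE.
have [j vj]: exists j, v 0 j != 0.
  apply/existsP; apply: contraNT vn0; rewrite negb_exists => /forallP v0.
  by apply/eqP/rowP => j; rewrite mxE; apply/eqP; rewrite -[_ == _]negbK v0.
by exists (enum_val j); rewrite ?enum_valP ?extend_row_enum.
Qed.

(** The product of the two incidence matrices has constant columns, hence rank
    at most 1, while Sylvester's inequality bounds its rank below by
    [#|P| + #|Q| - #|E|]. *)
Lemma indep_cross P Q (v : {set T} -> nat) : indep P -> indep Q ->
  {in P, forall A, A \subset E} ->
  {in P & Q, forall A B, #|A :&: B| = v B} -> (#|P| + #|Q| <= #|E|.+1)%N.
Proof.
move=> /indep_row_free /eqP rP /indep_row_free /eqP rQ sPE PQv.
have /eqP PQ : incidence P *m (incidence Q)^T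
    = const_mx 1 *m \row_j (v (enum_val j))%:R :> 'M[F]_(_, _).
  apply/matrixP => i j; rewrite !mxE big_ord1 !mxE mul1r.
  rewrite -(PQv _ _ (enum_valP i) (enum_valP j)) -[in RHS]sum1_card natr_sum.
  rewrite (eq_bigr (fun k => (enum_val k \in (enum_val i : {set T}))%:R
    * (enum_val k \in (enum_val j : {set T}))%:R)) => [|k _]; last by rewrite !mxE.
  rewrite (sum_incidence E (fun e => e \in (enum_val j : {set T}))
    (fun e => (e \in (enum_val i : {set T}))%:R)).
  rewrite big_mkcond [RHS]big_mkcond; apply: eq_bigr => e _; rewrite inE.
  case: (boolP (e \in enum_val i)) => [/(subsetP (sPE _ (enum_valP i))) -> //|_].
  by rewrite if_same.
have := mxrank_mul_min (incidence P) (incidence Q)^T.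
rewrite mxrank_tr rP rQ (eqP PQ) leq_subLR => /leq_trans -> //.
rewrite -[leqRHS]addn1 leq_add2l.
exact: leq_trans (mxrankM_maxl _ _) (rank_leq_col _).
Qed.

Lemma indep_sub P Q : Q \subset P -> indep P -> indep Q.
Proof.
move=> sQP indP c c0 D QD.
have := indP (fun A => if A \in Q then c A else 0) _ D (subsetP sQP _ QD).
rewrite QD; apply=> e Ee; rewrite -[RHS](c0 e Ee) -big_mkcondr /=.
apply: eq_bigl => A; case: (boolP (A \in Q)) => [/(subsetP sQP) ->|_].
  by rewrite andbT.
by rewrite andbF.
Qed.

Lemma indep_basis P : exists Q, [/\ Q \subset P, indep Q &
  forall D, D \in P -> exists u : {set T} -> F,
    forall e, e \in E -> (e \in D)%:R = \sum_(A in Q | e \in A) u A].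
Proof.
pose ok Q := (Q \subset P) && `[< indep Q >].
have ok0 : ok set0.
  by rewrite /ok sub0set; apply/asboolP => c _ D; rewrite inE.
case: (arg_maxnP (fun Q : {set {set T}} => #|Q|) ok0).
move=> Q /andP [sQP /asboolP indQ] maxQ; exists Q; split=> // D PD.
have [QD|nQD] := boolP (D \in Q).
  exists (fun A => (A == D)%:R) => e Ee; rewrite big_mkcondr (bigD1 D) //= eqxx.
  rewrite big1 ?addr0 => [|A /andP [_ /negPf ->]]; last by rewrite if_same.
  by case: (e \in D).
have [|c c0 [B DQB cB]] := @dependentP (D |: Q).
  move=> indDQ; have okDQ : ok (D |: Q).
    by rewrite /ok subUset sub1set PD sQP; apply/asboolP.
  by have := maxQ _ okDQ; rewrite cardsU1 nQD add1n /= ltnn.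
have c0' e : e \in E -> (e \in D)%:R * c D + \sum_(A in Q | e \in A) c A = 0.
  move=> Ee; rewrite -[RHS](c0 e Ee) big_mkcondr [X in _ = X]big_mkcondr big_setU1 //=.
  by congr (_ + _); case: (e \in D); rewrite ?mul1r ?mul0r.
have cD : c D != 0.
  apply/eqP => cD; move: DQB; rewrite in_setU1 => /predU1P [eqB|QB].
    by rewrite eqB cD eqxx in cB.
  move/eqP: cB; apply; apply: indQ QB => e Ee.
  by rewrite -[RHS](c0' e Ee) cD mulr0 add0r.
exists (fun A => - (c A / c D)) => e Ee; rewrite sumrN -mulr_suml.
apply: (mulIf cD); rewrite mulNr -mulrA mulVf // mulr1.
by apply/eqP; rewrite -addr_eq0 c0'.
Qed.

End Independence.

(** * Fractional covers that do not beat integral ones *)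

Section Roundable.

Variables (R : realType) (T : finType).
Implicit Types (C : clutter T) (w : T -> nat) (x : T -> R) (A B D : {set T}).
Local Open Scope ring_scope.

(** Idealness, without mention of an optimal solution: an integral feasible point
    is at least 1 on a cover, so an integral optimum exists exactly when no
    feasible point is cheaper than all covers. *)
Definition roundable C : Prop :=
  forall w x, lp_feasible C x ->
    exists2 B, is_cover C B & (\sum_(e in B) w e)%N%:R <= lp_value C w x.

Lemma feasible_set0 C x : lp_feasible C x -> set0 \notin members C.
Proof.
by case=> x1 _; apply/negP => /x1; rewrite big_set0 leNgt ltr01.
Qed.

Lemma sum_load_weight C x s : {subset s <= members C} ->
  \sum_(D <- s) \sum_(e in D) x e = \sum_(e in ground C) (load s e)%:R * x e.
Proof.
elim: s => [|D s IHs] sC.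
  by rewrite big_nil big1 // => e _; rewrite mul0r.
rewrite big_cons IHs => [|A sA]; last by apply: sC; rewrite inE sA orbT.
under [RHS]eq_bigr do rewrite natrD mulrDl.
rewrite big_split /=; congr (_ + _).
have /subsetP sD : D \subset ground C by rewrite members_sub ?sC ?mem_head.
rewrite big_mkcond [RHS]big_mkcond; apply: eq_bigr => e _.
case: (boolP (e \in D)) => [/sD ->|_]; first by rewrite mul1r.
by rewrite mul0r if_same.
Qed.

Lemma packing_lp_value C w x s : lp_feasible C x -> packing_list C w s ->
  (size s)%:R <= lp_value C w x.
Proof.
move=> [x1 x0] [sC ws]; apply: (@le_trans _ _ (\sum_(D <- s) \sum_(e in D) x e)).
  rewrite -sum1_size natr_sum big_seq [leRHS]big_seq.
  by apply: ler_sum => D /sC /x1.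
rewrite (sum_load_weight _ sC); apply: ler_sum => e Ee.
by rewrite ler_wpM2r ?x0 // ler_nat ws.
Qed.

(** A packing of the value of a cover bounds below the value of every
    fractional cover. *)
Lemma balanced_roundable C : (forall w, balanced C w) -> roundable C.
Proof.
move=> balC w x xC; case: (balC w) => [C0|[B [s [cB ws wBs]]]].
  by have := feasible_set0 xC; rewrite C0.
exists B => //; apply: le_trans (packing_lp_value xC ws).
by rewrite ler_nat.
Qed.

(** The incidence vector of a cover of minimum weight is an integral optimum. *)
Lemma roundable_ideal C : roundable C -> ideal R C.
Proof.
move=> rC; have [C0|C0] := boolP (set0 \in members C).
  left; apply/eqP; rewrite eqEsubset sub1set C0 andbT; apply/subsetP => D CD.
  by rewrite inE (members_antichain C0 CD (sub0set D)).
right=> w; have [B [BC cB] minB] := min_cover_exists w C0.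
exists (fun e => (e \in B)%:R); last by move=> e _; rewrite intr_nat.
have sumB (A : {set T}) (f : T -> R) :
    \sum_(e in A) f e * (e \in B)%:R = \sum_(e in B | e \in A) f e.
  rewrite big_mkcond [RHS]big_mkcond; apply: eq_bigr => e _.
  by case: (e \in A); case: (e \in B); rewrite ?mulr1 ?mulr0.
split=> [|x xC].
  split=> [D /cB BD|e _]; last exact: ler0n.
  rewrite -natr_sum ler1n lt0n sum_nat_eq0; apply: contra BD => /forallP BD.
  rewrite -subset0; apply/subsetP => e; rewrite inE => /andP [eB eD].
  by have := BD e; rewrite eD eB.
have [B' cB' wB'] := rC w x xC; apply: le_trans wB'; rewrite /lp_value sumB.
apply: le_trans (_ : (\sum_(e in B) w e)%N%:R <= _); last by rewrite ler_nat minB.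
rewrite natr_sum big_mkcond [leRHS]big_mkcond; apply: ler_sum => e _.
by case: (e \in ground C); case: (e \in B).
Qed.

End Roundable.

(** * Idealness from idealness of minors *)

Section DeBruijnErdos.

Variables (R : realFieldType) (T : finType) (E : {set T}) (Q : {set {set T}}).
Local Open Scope ring_scope.

(** The double counting of de Bruijn and Erdos. Give each pair [e \notin A] the
    weight [1 / #|E :\: A|]. Summed over [e] it is 1 for each [A], so the
    total is [#|Q|]. The bound compares it with the inverse of the number of
    members of [Q] missing [e], so the sum over [A] is at most 1 for each [e], and
    the total is at most [#|E|]. Hence all these sums are equal to 1. *)
Lemma complement_weights_column :
  (#|E| <= #|Q|)%N -> {in Q, forall A : {set T}, A \proper E} ->
  (forall (A : {set T}) e, A \in Q -> e \in E -> e \notin A ->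
    (#|A| + #|[set D in Q | e \notin D]| <= #|E|)%N) ->
  {in E, forall e, \sum_(A in Q | e \notin A) #|E :\: A|%:R^-1 = 1 :> R}.
Proof.
move=> leEQ propQ bound e0 Ee0.
pose g e : R := \sum_(A in Q | e \notin A) #|E :\: A|%:R^-1.
have g_le1 e : e \in E -> g e <= 1.
  move=> Ee; pose z := #|[set D in Q | e \notin D]|.
  have le_z : g e <= \sum_(A in Q | e \notin A) z%:R^-1.
    apply: ler_sum => A /andP [QA eA].
    have zA : (0 < z)%N by apply/card_gt0P; exists A; rewrite inE QA.
    have leEA : (z <= #|E :\: A|)%N.
      rewrite cardsDS ?proper_sub ?propQ // leq_subRL; first exact: bound QA Ee eA.
      by rewrite subset_leq_card // proper_sub ?propQ.
    by rewrite lef_pV2 ?posrE ?ltr0n ?ler_nat // (leq_trans zA).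
  apply: le_trans le_z _; rewrite sumr_const.
  have -> : #|[pred A in Q | e \notin A]| = z by apply: eq_card => A; rewrite !inE.
  have [->|z0] := posnP z; first by rewrite ler01.
  by rewrite -[_ *+ _]mulr_natr mulVf // pnatr_eq0 -lt0n.
have sum_g : \sum_(e in E) g e = #|Q|%:R.
  rewrite (exchange_big_dep (mem Q)) /=; last by move=> e A _ /andP [].
  rewrite -sum1_card natr_sum; apply: eq_bigr => A QA.
  rewrite sumr_const -[X in _ *+ X](_ : #|E :\: A| = _).
    rewrite -[_ *+ _]mulr_natr mulVf // pnatr_eq0 cards_eq0 setD_eq0.
    by have /properP [_ [e Ee eA]] := propQ A QA; apply/subsetPn; exists e.
  by apply: eq_card => e; rewrite !inE QA andbC.
have g_ge0 e : e \in E -> 0 <= 1 - g e by move=> Ee; rewrite subr_ge0 g_le1.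
have sum0 : \sum_(e in E) (1 - g e) = 0.
  apply/eqP; rewrite eq_le sumr_ge0 // andbT.
  by rewrite sumrB sum_g sumr_const subr_le0 ler_nat.
by apply/esym/eqP; rewrite -subr_eq0; apply/eqP; apply: (psumr_eq0P g_ge0 sum0).
Qed.

End DeBruijnErdos.

Section Lehman.

Variables (R : realType) (T : finType) (C : clutter T).
Implicit Types (w : T -> nat) (x : T -> R) (A B D : {set T}).
Local Open Scope ring_scope.

Hypothesis deletion_roundable :
  forall e, e \in ground C -> roundable R (minor C [set e] set0).
Hypothesis contraction_roundable :
  forall e, e \in ground C -> roundable R (minor C set0 [set e]).

(** A witness that [C] is not roundable at the weight [w]. *)
Definition undercuts w x : Prop :=
  lp_feasible C x /\
  forall B, is_cover C B -> lp_value C w x < (\sum_(e in B) w e)%N%:R.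

(** If [x e = 0] then [x] is feasible for the contraction of [e], whose covers are
    covers of [C]; rounding there contradicts that [x] undercuts them all. *)
Lemma undercuts_gt0 w x e : undercuts w x -> e \in ground C -> 0 < x e.
Proof.
move=> [[x1 x0] undx] Ee; rewrite lt_neqAle x0 // andbT; apply/eqP => xe0.
have [|B /is_cover_minor [BE cB]] := contraction_roundable Ee w (x := x).
  split=> [D /minor_lift [D' [CD' _ ->]]|f]; last first.
    by rewrite /= !inE => /andP [_]; apply: x0.
  apply: le_trans (x1 _ CD') _.
  rewrite big_mkcond [leRHS]big_mkcond; apply: ler_sum => f _.
  by rewrite !inE; case: eqP => [->|_]; rewrite -?xe0 ?if_same.
apply/negP; rewrite -ltNge; apply: le_lt_trans (undx B _); last first.
  split=> [|D CD]; first exact: subset_trans BE (subsetDl _ _).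
  by apply: cB => //; rewrite -setI_eq0 setI0.
rewrite /lp_value big_mkcond [leRHS]big_mkcond; apply: ler_sum => f _ /=.
rewrite !inE /=; case: eqP => [->|_] /=; last by [].
by case: ifP => // _; rewrite -xe0 mulr0.
Qed.

Lemma undercuts_not_cover w x B : undercuts w x -> is_cover C B ->
  ~ {in ground C, forall e, x e = (e \in B)%:R}.
Proof.
move=> [_ undx] [BC cB] xB; have := undx B (conj BC cB).
rewrite /lp_value natr_sum big_mkcond [ltRHS]big_mkcond /= => /lt_eqF/eqP; apply.
apply: eq_bigr => e _; case: ifP => [Ee|/negbT nEe].
  by rewrite xB //; case: (e \in B); rewrite ?mulr1 ?mulr0.
by rewrite (negPf (contra (subsetP BC e) nEe)).
Qed.

Definition tight x : {set {set T}} := [set D in members C | \sum_(e in D) x e == 1].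

(** Move [x] along [d] or its opposite, in the sense that does not raise the
    value and decreases some coordinate, until a constraint becomes tight. The
    end point still undercuts all covers, so it has positive coordinates, and
    the new tight constraint is a member. *)
Lemma undercuts_tighten w x (d : T -> R) e0 : undercuts w x ->
  {in tight x, forall D, \sum_(e in D) d e = 0} ->
  e0 \in ground C -> d e0 != 0 ->
  exists2 x', undercuts w x' & (#|tight x| < #|tight x'|)%N.
Proof.
move=> undx dorth Ee0 de0.
(* Up to a change of sign, [d] does not raise the value and has a negative
   coordinate: weights are nonnegative, so a direction of negative value has one,
   and along a direction of value 0 the sign of [d e0] can be chosen. *)
wlog [wd [e1 Ee1 de1]] : d dorth de0 / lp_value C w d <= 0 /\
    exists2 e, e \in ground C & d e < 0.
  move=> IH; have wN : lp_value C w (fun e => - d e) = - lp_value C w d.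
    by rewrite /lp_value -sumrN; apply: eq_bigr => e _; rewrite mulrN.
  have dorthN : {in tight x, forall D, \sum_(e in D) - d e = 0}.
    by move=> D /dorth dD; rewrite sumrN dD oppr0.
  have some_neg (d' : T -> R) : lp_value C w d' < 0 ->
      exists2 e, e \in ground C & d' e < 0.
    move=> wd'; apply: contrapT => d'0; move: wd'; apply/negP; rewrite -leNgt.
    apply: sumr_ge0 => e Ee; rewrite mulr_ge0 ?ler0n // leNgt; apply/negP => d'e.
    by apply: d'0; exists e.
  have [wd|wd|wd] := ltgtP (lp_value C w d) 0.
  - by apply: IH dorth de0 _; split; [exact: ltW | exact: some_neg].
  - apply: IH dorthN _ _; first by rewrite oppr_eq0.
    by split; [rewrite wN oppr_le0 ltW | apply: some_neg; rewrite wN oppr_lt0].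
  have [de|de|/eqP] := ltgtP (d e0) 0; last by rewrite (negPf de0).
    by apply: IH dorth de0 _; split; [rewrite wd | exists e0].
  apply: IH dorthN _ _; first by rewrite oppr_eq0.
  by split; [rewrite wN wd oppr0 | exists e0; rewrite // oppr_lt0].
have [[x1 x0] ltx] := undx.
(* [P] selects the constraints that the motion along [d] brings closer to
   equality, members on the left and coordinates on the right, and [t] is the
   time at which they become tight. *)
pose P (i : {set T} + T) := match i with
  | inl D => (D \in members C) && (\sum_(e in D) d e < 0)
  | inr e => (e \in ground C) && (d e < 0) end.
pose t (i : {set T} + T) := match i with
  | inl D => (\sum_(e in D) x e - 1) / - \sum_(e in D) d e
  | inr e => x e / - d e end.
have P1 : P (inr e1) by rewrite /P Ee1 de1.
case: (Order.TotalTheory.arg_minP t P1) => i Pi mini.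
have t0 : 0 <= t i.
  case: (i) Pi => [D|e] /= /andP [CD d0].
    by rewrite divr_ge0 ?subr_ge0 ?x1 // oppr_ge0 ltW.
  by rewrite divr_ge0 ?x0 // oppr_ge0 ltW.
pose x' e := x e + t i * d e.
have sumx' (D : {set T}) :
    \sum_(e in D) x' e = \sum_(e in D) x e + t i * \sum_(e in D) d e.
  by rewrite big_split -mulr_sumr.
have x'feas : lp_feasible C x'.
  split=> [D CD|e Ee]; first rewrite sumx'.
    have [d0|d0] := leP 0 (\sum_(e in D) d e).
      by rewrite -[leLHS]addr0 lerD ?x1 ?mulr_ge0.
    have /mini : P (inl D) by rewrite /P CD.
    by rewrite /= ler_pdivlMr ?oppr_gt0 // mulrN lerNl opprB lerBlDl.
  have [d0|d0] := leP 0 (d e); first by rewrite addr_ge0 ?x0 ?mulr_ge0.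
  have /mini : P (inr e) by rewrite /P Ee.
  by rewrite /= ler_pdivlMr ?oppr_gt0 // mulrN lerNl -subr_ge0 opprK addrC.
have undx' : undercuts w x'.
  split=> // B /ltx; apply: le_lt_trans.
  rewrite /lp_value (eq_bigr (fun e => (w e)%:R * x e + t i * ((w e)%:R * d e))).
    by rewrite big_split -mulr_sumr gerDl mulr_ge0_le0.
  by move=> e _; rewrite mulrDr mulrCA.
exists x' => //; apply: proper_card; apply/properP; split.
  apply/subsetP => D tD; move: (tD); rewrite !inE => /andP [-> /eqP eqD].
  by rewrite sumx' eqD dorth // mulr0 addr0 eqxx.
case: (i) Pi @t @x' t0 sumx' x'feas undx' {mini}
  => [D|e] /andP [CD d0] t x' _ sumx' _ undx'.
  exists D; last by rewrite inE CD /=; apply: contraTN d0 => /eqP tD;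
    rewrite dorth ?ltxx // inE CD tD eqxx.
  rewrite inE CD sumx' /= invrN mulrN mulNr divfK ?(negbT (lt_eqF d0)) //.
  by rewrite opprB addrC subrK.
have := undercuts_gt0 undx' CD.
by rewrite /x' /= invrN mulrN mulNr divfK ?(negbT (lt_eqF d0)) // subrr ltxx.
Qed.

(** Tightening as long as possible ends at a vertex, determined by its tight
    members alone. *)
Lemma undercuts_vertex w x : undercuts w x -> exists2 x', undercuts w x' &
  forall d : T -> R, {in tight x', forall D, \sum_(e in D) d e = 0} ->
    {in ground C, forall e, d e = 0}.
Proof.
have [k] := ubnP (#|{set T}| - #|tight x|); elim: k x => // k IHk x ltk undx.
have [vx|nvx] := EM (forall d : T -> R,
    {in tight x, forall D, \sum_(e in D) d e = 0} ->
    {in ground C, forall e, d e = 0}); first by exists x.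
suff [d [dorth [e Ee de]]] : exists d : T -> R,
    {in tight x, forall D, \sum_(e in D) d e = 0} /\
    exists2 e, e \in ground C & d e != 0.
  have [x' undx' tx'] := undercuts_tighten undx dorth Ee de.
  apply: (IHk x') => //; rewrite ltnS in ltk; apply: leq_trans ltk.
  by rewrite ltn_sub2l // (leq_trans tx') // max_card.
apply: contrapT => nd; apply: nvx => d dorth e Ee; apply/eqP.
by apply: contraPT isT => de _; apply: nd; exists d; split; last by exists e.
Qed.

Lemma deletion_members (I D : {set T}) : D \in members C -> [disjoint D & I] ->
  D \in members (minor C I set0).
Proof.
move=> CD dI; have [D' mD' sD'] := minor_shrink set0 CD dI.
have [D1 [CD1 _ eqD1]] := minor_lift mD'; rewrite !setD0 in eqD1 sD'.
by rewrite -(members_antichain CD1 CD) -?eqD1.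
Qed.

(** Round [x] in the deletion of [e] for the weight that counts the members of
    [P] through each element, lowered by 1 at [l]. The value of [x] is
    [#|P| - x l < #|P|], since the members of [P] are tight, whereas a cover [B]
    of the deletion meets each of them, so that its weight is at least
    [#|P| - (l \in B)]. Thus [l] is in [B], and no member of [P] is met
    twice. *)
Lemma transversal_cover w x (P : {set {set T}}) e l :
  undercuts w x -> P \subset tight x -> e \in ground C ->
  {in P, forall D, e \notin D} -> (exists2 D, D \in P & l \in D) ->
  exists B, [/\ B \subset ground C, e \notin B, l \in B &
    {in P, forall D : {set T}, #|D :&: B| = 1%N}].
Proof.
move=> undx /subsetP tP Ee eP [Dl PDl Dll]; have [[x1 x0] _] := undx.
have CP D : D \in P -> D \in members (minor C [set e] set0).
  move=> PD; apply: deletion_members; last by rewrite disjoint_sym disjoints1 eP.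
  by have := tP _ PD; rewrite inE => /andP [].
pose s := enum P; have sP D : (D \in s) = (D \in P) by rewrite mem_enum.
have sC : {subset s <= members (minor C [set e] set0)}.
  by move=> D; rewrite sP => /CP.
pose v f := (load s f - (f == l))%N.
have vE f : (v f + (f == l) = load s f)%N.
  rewrite /v subnK //; case: eqP => // ->; rewrite /load -has_count.
  by apply/hasP; exists Dl; rewrite ?sP.
have [|B cB] := deletion_roundable Ee v (x := x).
  split=> [D /minor_lift [D' [CD' _ ->]]|f]; first by rewrite setD0 x1.
  by rewrite !inE => /andP [_ Ef]; apply: x0.
have xl : 0 < x l.
  apply: undercuts_gt0 undx _; have := tP _ PDl; rewrite inE.
  by move=> /andP [/members_sub /subsetP + _]; apply.
have -> : lp_value (minor C [set e] set0) v x = (size s)%:R - x l.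
  have <- : \sum_(D <- s) \sum_(f in D) x f = (size s)%:R.
    rewrite -sum1_size natr_sum big_seq [RHS]big_seq; apply: eq_bigr => D.
    by rewrite sP => /tP; rewrite inE => /andP [_ /eqP].
  rewrite (sum_load_weight _ sC) /lp_value; apply/eqP; rewrite eq_sym subr_eq.
  apply/eqP; under eq_bigr do rewrite -vE natrD mulrDl.
  rewrite big_split /=; congr (_ + _).
  rewrite (bigD1 l) /=; last by rewrite (subsetP (members_sub (CP _ PDl))).
  rewrite eqxx mul1r big1 ?addr0 // => f /andP [_ /negPf ->].
  by rewrite mul0r.
move=> vB; have {}vB : (\sum_(f in B) v f < size s)%N.
  by rewrite -(ltr_nat R); apply: le_lt_trans vB _; rewrite gtrBl.
have sumvB : (\sum_(f in B) v f + (l \in B) = \sum_(D <- s) #|B :&: D|)%N.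
  rewrite -sum_load -(eq_bigr _ (fun f _ => vE f)) big_split /=; congr (_ + _)%N.
  have [lB|lB] := boolP (l \in B).
    by rewrite (bigD1 l) //= eqxx big1 // => f /andP [_ /negPf ->].
  by rewrite big1 // => f fB; case: eqP => // eqf; rewrite -eqf fB in lB.
have geB D : D \in s -> (1 <= #|B :&: D|)%N.
  by move=> /sC; case: cB => _ cB /cB; rewrite card_gt0.
have geBs : (size s <= \sum_(D <- s) #|B :&: D|)%N.
  by rewrite -sum1_size big_seq [leqRHS]big_seq; apply: leq_sum.
have lB : l \in B.
  by move: geBs; rewrite -sumvB; case: (l \in B) => //; rewrite addn0 leqNgt vB.
have [/subsetDP [BE dBe] _] := (is_cover_minor _ _ _ _).1 cB.
exists B; split=> //; first by move: dBe; rewrite setU0 disjoint_sym disjoints1.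
move=> D PD; apply/eqP; rewrite eqn_leq setIC geB ?sP // andbT leqNgt.
apply/negP => gtB; move: vB; apply/negP; rewrite -leqNgt.
move: sumvB; rewrite lB addn1 -ltnS => ->.
have sD : D \in s by rewrite sP.
rewrite -sum1_size !(bigD1_seq D) ?enum_uniq //= -addSn leq_add //.
rewrite big_seq_cond [leqRHS]big_seq_cond.
by apply: leq_sum => D' /andP [/geB].
Qed.


(** For each [l] in [A], a transversal cover of the members of [Q] missing [e]
    that contains [l] meets [A] only in [l]. Together with [[set e]] these
    [#|A| + 1] sets have distinct traces of one element on [e |: A], so they are
    independent, and each of them meets all members of [Q] missing [e] equally
    often: once, or never for [[set e]]. Then [indep_cross] applies. *)
Lemma avoiding_members_bound w x (Q : {set {set T}}) A e : undercuts w x ->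
  Q \subset tight x -> indep R (ground C) Q ->
  A \in Q -> e \in ground C -> e \notin A ->
  (#|A| + #|[set D in Q | e \notin D]| <= #|ground C|)%N.
Proof.
move=> undx tQ indQ QA Ee eA; set P := [set D in Q | e \notin D].
have sPQ : P \subset Q by apply/subsetP => D; rewrite inE => /andP [].
have CQ D : D \in Q -> D \subset ground C.
  by move=> /(subsetP tQ); rewrite inE => /andP [/members_sub].
have PA : A \in P by rewrite inE QA.
have exb l : exists B : {set T}, l \in A ->
    [/\ B \subset ground C, e \notin B, l \in B &
      {in P, forall D : {set T}, #|D :&: B| = 1%N}].
  have [lA|nlA] := boolP (l \in A); last by exists set0.
  have [||B BP] := transversal_cover (l := l) undx (subset_trans sPQ tQ) Ee.
  - by move=> D; rewrite inE => /andP [].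
  - by exists A.
  by exists B.
have [b bP] := choice exb.
pose b' l := if l == e then [set e] else b l; pose L := e |: A.
have b'L l l' : l \in L -> l' \in L -> (l' \in b' l) = (l' == l).
  rewrite /b' !in_setU1; case: eqP => [->|_] /=; first by rewrite inE.
  move=> lA /predU1P [->|l'A].
    have [_ /negPf -> _ _] := bP l lA; apply/esym/negbTE.
    by apply: contraNneq eA => ->.
  have [_ _ lb bA] := bP l lA; apply/idP/eqP => [l'b|-> //].
  have /eqP/cards1P [f Abf] := bA A PA.
  have : l \in A :&: b l by rewrite inE lA lb.
  have : l' \in A :&: b l by rewrite inE l'A l'b.
  by rewrite Abf !inE => /eqP -> /eqP ->.
have b'inj : {in L &, injective b'}.
  by move=> l l' Ll Ll' eqb; apply/eqP; rewrite -(b'L l' l) // -eqb b'L.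
have LE : L \subset ground C by rewrite subUset sub1set Ee CQ.
have indL : indep R (ground C) (b' @: L).
  move=> c c0 _ /imsetP [l Ll ->]; rewrite -(c0 l) ?(subsetP LE) //.
  rewrite (bigD1 (b' l)) ?imset_f ?b'L //= big1 ?addr0 // => D.
  case/andP=> /andP [/imsetP [l' Ll' ->]]; rewrite b'L // => /eqP ->.
  by rewrite eqxx.
have := indep_cross (v := fun B => (B != [set e]) : nat) (indep_sub sPQ indQ) indL.
rewrite card_in_imset // cardsU1 eA add1n addnS ltnS addnC; apply.
  by move=> D /(subsetP sPQ) /CQ.
move=> D _ PD /imsetP [l Ll ->]; have [eqle|nle] := eqVneq l e.
  rewrite /b' eqle !eqxx; apply/eqP; rewrite cards_eq0 setI_eq0 disjoint_sym.
  by rewrite disjoints1; move: PD; rewrite inE => /andP [].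
have -> : b' l != [set e].
  apply: contraNneq nle => eqb; have := b'L l e Ll.
  by rewrite eqb in_setU1 inE eqxx eq_sym => /(_ isT) <-.
rewrite /b' (negPf nle); have [|_ _ _ -> //] := bP l.
by move: Ll; rewrite in_setU1 (negPf nle).
Qed.

(** A consequence of Lehman's theorem on minimally nonideal clutters: they do not
    pack. Let [x] be a vertex that undercuts all covers and [Q] a
    basis of its tight members. By [complement_weights_column] the weights
    [y A = 1 / #|ground C :\: A|] load all elements equally, by [Y - 1] where
    [Y] is their sum. Hence [Y = (Y - 1) * X], where [X] is the sum of the [x e].
    A packing with unit capacities has at most [X] members. A cover [B] meets some member of [Q]
    twice, as otherwise its incidence vector would solve the linear system that
    determines [x]; hence [Y < (Y - 1) * #|B|], and [B] has more than [X]
    elements. *)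
Lemma roundable_of_minors : balanced C (fun=> 1%N) -> roundable R C.
Proof.
move=> bal1 w x0 x0C; apply: contrapT => nB.
have undx0 : undercuts w x0.
  split=> // B cB; rewrite ltNge; apply/negP => leB; apply: nB.
  by exists B.
have [x undx vx] := undercuts_vertex undx0; have [xC ltx] := undx.
have [Q [tQ indQ spanQ]] := indep_basis R (ground C) (tight x).
have CQ A : A \in Q -> A \in members C.
  by move=> /(subsetP tQ); rewrite inE => /andP [].
have xQ A : A \in Q -> \sum_(e in A) x e = 1.
  by move=> /(subsetP tQ); rewrite inE => /andP [_ /eqP].
have sumE (A : {set T}) (f : T -> R) : A \in members C ->
    \sum_(e in A) f e = \sum_(e in ground C | e \in A) f e.
  move=> /members_sub /subsetP sA; apply: eq_bigl => e.
  by case: (boolP (e \in A)) => [/sA ->|]; rewrite ?andbF.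
(* [Q] spans the tight members, so it determines [x] as they do. *)
have vQ (d : T -> R) : {in Q, forall A, \sum_(e in A) d e = 0} ->
    {in ground C, forall e, d e = 0}.
  move=> dQ; apply: vx => D tD; have [u uD] := spanQ D tD.
  have CD : D \in members C by move: tD; rewrite inE => /andP [].
  rewrite sumE // big_mkcondr /=.
  rewrite (eq_bigr (fun e => \sum_(A in Q | e \in A) u A * d e)) => [|e Ee].
    rewrite (exchange_big_dep (mem Q)) /=; last by move=> e A _ /andP [].
    rewrite big1 // => A QA; rewrite -mulr_sumr.
    suff -> : \sum_(e in ground C | (A \in Q) && (e \in A)) d e = 0 by rewrite mulr0.
    rewrite -[RHS](dQ A QA) (sumE _ _ (CQ A QA)).
    by apply: eq_bigl => e; rewrite QA.
  by rewrite -mulr_suml -uD //; case: (e \in D); rewrite ?mul1r ?mul0r.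
have no_transversal B : is_cover C B -> ~ {in Q, forall A, #|A :&: B| = 1%N}.
  move=> cB QB; apply: (undercuts_not_cover undx cB) => e Ee.
  apply/eqP; rewrite -subr_eq0; apply/eqP; move: e Ee; apply: vQ => A QA.
  rewrite sumrB xQ // -natr_sum -big_mkcondr /= sum1_card.
  have -> : #|[pred e in A | e \in B]| = 1%N.
    by rewrite -(QB A QA); apply: eq_card => e; rewrite !inE.
  by rewrite subrr.
have leEQ : (#|ground C| <= #|Q|)%N.
  rewrite leqNgt; apply/negP => /(nonzero_orthogonal R) [d dQ [e Ee /eqP]]; apply.
  by apply: vQ Ee => A QA; rewrite sumE ?CQ ?dQ.
(* If the ground set were a member it would be the only one, and any single
   element would be a cover meeting it once. *)
have propQ : {in Q, forall A, A \proper ground C}.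
  move=> A QA; rewrite properEneq members_sub ?CQ // andbT.
  apply/eqP => eqA; have allA D : D \in members C -> D = A.
    by move=> CD; apply: (members_antichain CD (CQ A QA)); rewrite eqA members_sub.
  have [e Ae] : exists e, e \in A.
    apply/set0Pn; apply: contraTneq (CQ A QA) => ->.
    exact: feasible_set0 xC.
  apply: (no_transversal [set e]) => [|D QD].
    split=> [|D /allA ->]; first by rewrite sub1set -eqA.
    by apply/set0Pn; exists e; rewrite !inE eqxx.
  rewrite (allA D (CQ D QD)); apply/eqP/cards1P; exists e.
  by apply/setIidPr; rewrite sub1set.
have colQ := complement_weights_column R leEQ propQ
  (fun A e => avoiding_members_bound undx tQ indQ (A := A) (e := e)).
pose y (A : {set T}) : R := #|ground C :\: A|%:R^-1.
have y0 A : A \in Q -> 0 < y A.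
  move=> /propQ /properP [_ [e Ee eA]]; rewrite invr_gt0 ltr0n card_gt0.
  by apply/set0Pn; exists e; rewrite inE eA.
pose Y := \sum_(A in Q) y A.
have col e : e \in ground C -> \sum_(A in Q | e \in A) y A = Y - 1.
  move=> /colQ cole.
  by rewrite /Y [X in X - 1](bigID (fun A : {set T} => e \in A)) /= cole addrK.
pose X := \sum_(e in ground C) x e.
have sum_col (f : T -> R) : \sum_(A in Q) y A * \sum_(e in A) f e
    = (Y - 1) * \sum_(e in ground C) f e.
  under eq_bigr => A QA do rewrite sumE ?CQ // mulr_sumr.
  rewrite (exchange_big_dep (mem (ground C))) /=; last by move=> A e _ /andP [].
  rewrite mulr_sumr; apply: eq_bigr => e Ee; rewrite -(col e Ee) mulr_suml.
  by apply: eq_bigl => A; rewrite Ee.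
have YX : Y = (Y - 1) * X.
  rewrite -sum_col; apply: eq_bigr => A QA; by rewrite xQ ?mulr1.
have X0 : 0 <= X by apply: sumr_ge0 => e Ee; apply: xC.2.
case: bal1 => [C0|[B [s [cB ws Bs]]]].
  by have := feasible_set0 xC; rewrite C0.
have leBX : #|B|%:R <= X.
  apply: le_trans (_ : (size s)%:R <= _); first by rewrite ler_nat -sum1_card.
  apply: le_trans (packing_lp_value xC ws) _; rewrite le_eqVlt; apply/orP; left.
  by apply/eqP/eq_bigr => e _; rewrite mul1r.
have [A QA AB] : exists2 A, A \in Q & (1 < #|A :&: B|)%N.
  apply: contrapT => nAB; apply: (no_transversal B cB) => A QA.
  apply/eqP; rewrite eqn_leq setIC card_gt0 cB.2 ?CQ // andbT leqNgt setIC.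
  by apply/negP => ?; apply: nAB; exists A.
have ltY : Y < (Y - 1) * #|B|%:R.
  have -> : #|B|%:R = \sum_(e in ground C) (e \in B)%:R :> R.
    rewrite -natr_sum -big_mkcondr /= sum1_card; congr (_%:R); apply: eq_card => e.
    by apply/idP/andP => [eB|[]//]; split; first exact: (subsetP cB.1).
  have sumB D : \sum_(e in D) (e \in B)%:R = #|D :&: B|%:R :> R.
    rewrite -natr_sum -big_mkcondr /= sum1_card; congr (_%:R); apply: eq_card => e.
    by rewrite !inE.
  rewrite -sum_col /Y (bigD1 A) //= [ltRHS](bigD1 A) //=; apply: ltr_leD.
    by rewrite sumB ltr_pMr ?y0 // ltr1n.
  apply: ler_sum => D /andP [QD _]; rewrite sumB ler_peMr ?(ltW (y0 D QD)) // ler1n.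
  by rewrite setIC card_gt0 cB.2 ?CQ.
have Y0 : 0 < Y.
  rewrite /Y (bigD1 A) //= ltr_wpDr ?y0 // sumr_ge0 // => D /andP [QD _].
  by rewrite ltW ?y0.
have Y1 : 0 <= Y - 1.
  by rewrite leNgt; apply/negP => Y1; move: Y0; rewrite YX ltNge mulr_le0_ge0 // ltW.
by move: ltY; rewrite {1}YX ltNge ler_wpM2l.
Qed.

End Lehman.

(** * Linear programming duality *)

Section Farkas.

Variables (R : realFieldType) (V : lmodType R) (J : finType).
Local Open Scope ring_scope.

Lemma scalar_0 (f : V -> R) : scalar f -> f 0 = 0.
Proof. by move=> linf; have := linf (-1) 0 0; rewrite scaler0 addr0 mulN1r addNr. Qed.

Lemma scalar_Z (f : V -> R) k u : scalar f -> f (k *: u) = k * f u.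
Proof. by move=> linf; have := linf k u 0; rewrite scalar_0 // !addr0. Qed.

(** Bartl's induction on the number of forms. If the positivity of [b] uses
    [a j], there is [x1] with [a j x1 = 1], [b x1 > 0] and [a i x1 <= 0] for the other
    forms; compose all forms with the projection [x - a j x *: x1] onto the kernel of
    [a j], apply induction, and give to [a j] the coefficient that corrects
    the values at [x1]. *)
Lemma farkas_seq (s : seq J) (a : J -> V -> R) (b : V -> R) :
  uniq s -> (forall j, scalar (a j)) -> scalar b ->
  (forall x, (forall j, j \in s -> 0 <= a j x) -> 0 <= b x) ->
  exists2 y : J -> R, forall j, j \in s -> 0 <= y j &
    forall x, b x = \sum_(j <- s) y j * a j x.
Proof.
elim: s a b => [|j s IHs] a b /=.
  move=> _ _ linb b0; exists (fun=> 0) => // x; rewrite big_nil.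
  apply/eqP; rewrite eq_le b0 // andbT -oppr_ge0 -mulN1r -scalar_Z //.
  exact: b0.
move=> /andP [js us] lina linb ab.
have linK (f : V -> R) : scalar f -> forall k u v, f (v - k *: u) = f v - k * f u.
  by move=> linf k u v; rewrite addrC -scaleNr linf mulNr addrC.
have [bs|nbs] := EM (forall x, (forall j, j \in s -> 0 <= a j x) -> 0 <= b x).
  have [y y0 bE] := IHs a b us lina linb bs.
  exists (fun i => if i == j then 0 else y i) => [i|x].
    by rewrite inE; case: eqP => //= _; apply: y0.
  rewrite big_cons eqxx mul0r add0r bE !big_seq; apply: eq_bigr => i si.
  by case: eqP => // eqij; rewrite -eqij si in js.
have [x0 ax0 bx0] : exists2 x, forall i, i \in s -> 0 <= a i x & b x < 0.
  apply: contrapT => nx; apply: nbs => x ax; rewrite leNgt; apply/negP => bx.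
  by apply: nx; exists x.
have ajx0 : a j x0 < 0.
  rewrite ltNge; apply: contraTN bx0 => ajx0; rewrite -leNgt; apply: ab => i.
  by rewrite inE => /predU1P [->|/ax0].
pose x1 := (a j x0)^-1 *: x0.
have ajx1 : a j x1 = 1 by rewrite scalar_Z // mulVf // lt_eqF.
have ax1 i : i \in s -> a i x1 <= 0.
  by move=> /ax0 ai0; rewrite scalar_Z // mulr_le0_ge0 // invr_le0 ltW.
have bx1 : 0 < b x1 by rewrite scalar_Z // nmulr_rgt0 ?invr_lt0.
have linp (f : V -> R) : scalar f -> scalar (fun x => f (x - a j x *: x1)).
  move=> linf k u v /=; rewrite !linK // linf lina; ring.
have [|y y0 bE] := IHs (fun i x => a i (x - a j x *: x1))
  (fun x => b (x - a j x *: x1)) us (fun i => linp _ (lina i)) (linp _ linb).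
  move=> x ax; apply: ab => i; rewrite inE => /predU1P [->|/ax //].
  by rewrite linK // ajx1 mulr1 subrr.
pose c := b x1 - \sum_(i <- s) y i * a i x1.
have c0 : 0 <= c.
  rewrite addr_ge0 ?(ltW bx1) // oppr_ge0 big_seq; apply: sumr_le0 => i si.
  by rewrite mulr_ge0_le0 ?y0 ?ax1.
exists (fun i => if i == j then c else y i) => [i|x].
  by rewrite inE; case: eqP => //= _; apply: y0.
rewrite big_cons eqxx.
have -> : \sum_(i <- s) (if i == j then c else y i) * a i x = \sum_(i <- s) y i * a i x.
  rewrite !big_seq; apply: eq_bigr => i si.
  by case: eqP => // eqij; rewrite -eqij si in js.
have := bE x; rewrite linK //; under eq_bigr do rewrite linK // mulrBr mulrCA.
rewrite sumrB -mulr_sumr => /eqP; rewrite subr_eq => /eqP ->; rewrite /c; ring.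
Qed.

Lemma farkas (P : {pred J}) (a : J -> V -> R) (b : V -> R) :
  (forall j, scalar (a j)) -> scalar b ->
  (forall x, (forall j, P j -> 0 <= a j x) -> 0 <= b x) ->
  exists2 y : J -> R, forall j, P j -> 0 <= y j &
    forall x, b x = \sum_(j | P j) y j * a j x.
Proof.
move=> lina linb ab.
have [x ax|y y0 bE] := farkas_seq (enum_uniq P) lina linb.
  by apply: ab => j Pj; apply: ax; rewrite mem_enum.
exists y => [j Pj|x]; first by rewrite y0 // mem_enum.
by rewrite bE big_enum.
Qed.

End Farkas.

Section FractionalPacking.

Variables (R : realType) (T : finType) (C : clutter T) (w : T -> nat) (k : nat).
Local Open Scope ring_scope.

(** Farkas' lemma in the space of pairs formed by a vector on [T] and a scalar,
    the coordinate at [None], which homogenizes the covering constraints: the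
    form [w . x - k * x None] is nonnegative where all [x(D) - x None] and [x e] are.
    The coefficients of the former are the packing, those of the latter its
    slacks. *)
Lemma fractional_packing : roundable R C ->
  (forall B, is_cover C B -> (k <= \sum_(e in B) w e)%N) ->
  exists y : {set T} -> R,
    [/\ forall D, D \in members C -> 0 <= y D,
        forall e, e \in ground C -> \sum_(D in members C | e \in D) y D <= (w e)%:R &
        \sum_(D in members C) y D = k%:R].
Proof.
move=> rC lek.
pose V := {ffun option T -> R^o}.
pose a (j : {set T} + T) (x : V) : R := match j with
  | inl D => \sum_(e in D) x (Some e) - x None
  | inr e => x (Some e) end.
pose b (x : V) : R := \sum_(e in ground C) (w e)%:R * x (Some e) - k%:R * x None.
pose P (j : {set T} + T) := match j with
  | inl D => D \in members C | inr e => e \in ground C end.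
have [j|||y y0 bE] := @farkas R V _ P a b.
- case: j => [D|e] c u v; rewrite /a ?ffunE //.
  under eq_bigr do rewrite !ffunE; rewrite big_split -mulr_sumr /=. 
  by rewrite /GRing.scale /=; ring.
- move=> c u v; rewrite /b !ffunE; under eq_bigr do rewrite !ffunE mulrDr mulrCA.
  rewrite big_split -mulr_sumr /= /GRing.scale /=; ring.
- move=> x ax; rewrite subr_ge0.
  have x0 e : e \in ground C -> 0 <= x (Some e) by move=> Ee; apply: (ax (inr e)).
  have wx0 : 0 <= \sum_(e in ground C) (w e)%:R * x (Some e).
    by apply: sumr_ge0 => e Ee; rewrite mulr_ge0 ?x0.
  have [t0|t0] := leP (x None) 0; first by rewrite (le_trans _ wx0) ?mulr_ge0_le0.
  have [|B /lek leB wB] := rC w (fun e => x (Some e) / x None).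
    split=> [D CD|e Ee]; last by rewrite divr_ge0 ?x0 ?ltW.
    by rewrite -mulr_suml ler_pdivlMr // mul1r -subr_ge0; apply: (ax (inl D)).
  rewrite -ler_pdivlMr //; apply: le_trans (_ : (\sum_(e in B) w e)%N%:R <= _).
    by rewrite ler_nat.
  apply: le_trans wB _; rewrite /lp_value mulr_suml le_eqVlt; apply/orP; left.
  by apply/eqP/eq_bigr => e _; rewrite mulrA.
exists (fun D => y (inl D)); split=> [D CD|e Ee|]; first exact: (y0 (inl D)).
- pose x : V := [ffun o => (o == Some e)%:R].
  have sumx (A : {set T}) (f : T -> R) :
      \sum_(g in A) f g * x (Some g) = if e \in A then f e else 0.
    rewrite (eq_bigr (fun g => if g == e then f g else 0)) => [|g _].
      rewrite -big_mkcondr big_mkcond (bigD1 e) //= eqxx andbT.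
      by rewrite big1 ?addr0 // => g /negPf ->; rewrite andbF.
    by rewrite ffunE (inj_eq Some_inj); case: eqP; rewrite ?mulr1 ?mulr0.
  have := bE x; rewrite /b big_sumType /= [x None]ffunE /= mulr0 subr0 !sumx Ee.
  move=> ->.
  have -> : \sum_(D in members C | e \in D) y (inl D)
      = \sum_(D in members C) y (inl D) * (\sum_(f in D) x (Some f) - 0).
    rewrite big_mkcondr; apply: eq_bigr => D _; rewrite subr0.
    have := sumx D (fun=> 1); under eq_bigr do rewrite mul1r.
    by move=> ->; case: ifP; rewrite ?mulr1 ?mulr0.
  by rewrite lerDl y0.
- pose x : V := [ffun o => - (o == None)%:R].
  have xS f : x (Some f) = 0 by rewrite ffunE oppr0.
  have := bE x; rewrite /b big_sumType /= [x None]ffunE /= mulrN1 opprK.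
  rewrite big1 ?add0r => [->|f _]; last by rewrite xS mulr0.
  rewrite [X in _ = _ + X]big1 ?addr0 => [|f _]; last by rewrite xS mulr0.
  apply: eq_bigr => D _; rewrite big1 => [|f _]; last exact: xS.
  by rewrite sub0r opprK mulr1.
Qed.

End FractionalPacking.

(** * The total weight of a minimal gap *)

(** With [q = n + 1 - r >= k], the two bounds read
    [4 * W <= (n - 1) ^ 2 - (r - q) ^ 2] and
    [4 * W <= (n - 1) ^ 2 - (r - q + 2) ^ 2]; the two squares are not both
    zero. *)
Lemma lt_quarter_square (W n r k : nat) : (0 < n)%N ->
  (W + n <= r * k)%N -> (W + 2 * r <= r * k)%N -> (k + r <= n.+1)%N ->
  (4 * W < (n - 1) ^ 2)%N.
Proof.
move=> n0 Wn Wr kr; have kE : (k <= n.+1 - r)%N by lia.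
have rn : (r <= n.+1)%N by lia.
have {}Wn : (W + n <= r * (n.+1 - r))%N.
  by apply: leq_trans Wn _; rewrite leq_mul2l kE orbT.
have {}Wr : (W + 2 * r <= r * (n.+1 - r))%N.
  by apply: leq_trans Wr _; rewrite leq_mul2l kE orbT.
have [q qE] : exists q, n.+1 = (r + q)%N by exists (n.+1 - r)%N; lia.
rewrite qE addKn in Wn Wr; rewrite (_ : n = r + q - 1)%N in Wn *; last by lia.
rewrite expnS expn1.
have [ltrq|ltqr|eqrq] := ltngtP r q.
- have [c cE] : exists c, q = (r + c.+1)%N by exists (q - r).-1; lia.
  subst q; nia.
- have [c cE] : exists c, r = (q + c.+1)%N by exists (r - q).-1; lia.
  subst r; nia.
- subst q; nia.
Qed.

(** A roundable clutter at a weight [w] of smallest total with a duality gap: [w]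
    is positive, and lowering it at any element closes the gap. *)
Section MinimalGap.

Variables (R : realType) (T : finType) (C : clutter T) (w : T -> nat).
Implicit Types (A B D : {set T}).

Hypothesis roundC : roundable R C.
Hypothesis gap : ~ balanced C w.
Hypothesis below_balanced : forall v, {in ground C, forall e, v e <= w e} ->
  \sum_(e in ground C) v e < \sum_(e in ground C) w e -> balanced C v.
Hypothesis w_gt0 : {in ground C, forall e, 0 < w e}.
Hypothesis no_singleton_cover : forall e, ~ is_cover C [set e].

Lemma gap_set0 : set0 \notin members C.
Proof. by apply/negP => C0; apply: gap; left. Qed.

Lemma gap_packing B s : is_cover C B -> packing_list C w s ->
  size s < \sum_(e in B) w e.
Proof.
by move=> cB ws; rewrite ltnNge; apply/negP => leBs; apply: gap; right; exists B, s.
Qed.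

Variable t : nat.
Hypothesis t_attained : exists2 B, is_cover C B & \sum_(e in B) w e = t.
Hypothesis t_min : forall B, is_cover C B -> t <= \sum_(e in B) w e.

Definition min_covers : {set {set T}} :=
  [set B | `[< is_cover C B >] && (\sum_(e in B) w e == t)].

Lemma min_coversP B :
  reflect (is_cover C B /\ \sum_(e in B) w e = t) (B \in min_covers).
Proof.
rewrite inE; apply: (iffP andP) => [[/asboolP cB /eqP wB]|[cB wB]] //.
by split; [apply/asboolP | apply/eqP].
Qed.

(** Lower [w] by 1 at [e]. The optimal packing for the lowered weight is
    a packing for [w], so it has less than [t] members; the optimal cover
    for the lowered weight must then contain [e] and have [w]-weight [t]. *)
Lemma in_min_cover e : e \in ground C -> exists2 B, B \in min_covers & e \in B.
Proof.
move=> Ee; pose v f := w f - (f == e).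
have vE f : f \in ground C -> v f + (f == e) = w f.
  by move=> Ef; rewrite subnK //; case: eqP => // _; apply: w_gt0.
have lev : {in ground C, forall f, v f <= w f} by move=> f _; apply: leq_subr.
have [|C0|[B [s [cB [sC vs] leBs]]]] := below_balanced lev.
- rewrite (bigD1 e) // [ltnRHS](bigD1 e) //= /v eqxx -addSn leq_add //.
    by rewrite subn1 prednK ?w_gt0.
  by apply: leq_sum => f _; apply: leq_subr.
- by have := gap_set0; rewrite C0.
have ws : packing_list C w s by split=> // f Ef; apply: leq_trans (vs f Ef) (lev f Ef).
have sumv : \sum_(f in B) w f = \sum_(f in B) v f + (e \in B).
  rewrite (eq_bigr (fun f => v f + (f == e))) => [|f /(subsetP cB.1) /vE //].
  rewrite big_split /=; congr (_ + _); have [eB|eB] := boolP (e \in B).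
    by rewrite (bigD1 e) //= eqxx big1 // => f /andP [_ /negPf ->].
  by rewrite big1 // => f fB; case: eqP => // eqf; rewrite -eqf fB in eB.
have [B0 cB0 wB0] := t_attained.
have := gap_packing cB ws; have := gap_packing cB0 ws; rewrite wB0 sumv.
case eB: (e \in B); last by move=> _; rewrite addn0 ltnNge leBs.
move=> lts _; exists B => //; apply/min_coversP; split=> //.
by apply/eqP; rewrite eqn_leq t_min // andbT sumv eB addn1 (leq_trans _ lts).
Qed.

Lemma min_cover_card B : B \in min_covers -> 1 < #|B|.
Proof.
move=> /min_coversP [cB wB]; rewrite ltn_neqAle eq_sym; apply/andP; split.
  by apply/negP => /cards1P [e eqB]; apply: (no_singleton_cover (e := e)); rewrite -eqB.
rewrite card_gt0; apply/eqP => B0; apply: gap; right; exists B, [::].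
by split=> //; rewrite B0 big_set0.
Qed.

Local Open Scope ring_scope.
Implicit Types (y : {set T} -> R).

Definition optimal_fractional y : Prop :=
  [/\ forall D, D \in members C -> 0 <= y D,
      forall e, e \in ground C -> \sum_(D in members C | e \in D) y D <= (w e)%:R &
      \sum_(D in members C) y D = t%:R].

Definition supp y := [set D in members C | y D != 0].

Lemma sum_cover_load B y : is_cover C B ->
  \sum_(e in B) \sum_(D in members C | e \in D) y D
  = \sum_(D in members C) y D * #|D :&: B|%:R.
Proof.
move=> [BC _]; rewrite (exchange_big_dep (mem (members C))) /=; last first.
  by move=> e D _ /andP [].
apply: eq_bigr => D CD; rewrite sumr_const -[LHS]mulr_natr; congr (_ * _%:R).
by apply: eq_card => e; rewrite !inE CD andbC.
Qed.

(** The weight of [B] and the value of [y] are both [t], so the two inequalities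
    between them, through the loads on [B], are equalities term by term. *)
Lemma complementary_slackness B y : optimal_fractional y -> B \in min_covers ->
  {in B, forall e, \sum_(D in members C | e \in D) y D = (w e)%:R} /\
  {in supp y, forall D, #|D :&: B| = 1%N}.
Proof.
move=> [y0 yw yt] /min_coversP [cB wB]; have [BC BD] := cB.
pose f e : R := (w e)%:R - \sum_(D in members C | e \in D) y D.
pose g D : R := y D * (#|D :&: B|%:R - 1).
have f0 e : e \in B -> 0 <= f e by move=> /(subsetP BC) /yw; rewrite subr_ge0.
have g0 D : D \in members C -> 0 <= g D.
  by move=> CD; rewrite mulr_ge0 ?y0 // subr_ge0 ler1n card_gt0 setIC BD.
have fg : \sum_(e in B) f e + \sum_(D in members C) g D = 0.
  rewrite sumrB sum_cover_load // -natr_sum wB.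
  rewrite [X in _ + X](eq_bigr (fun D => y D * #|D :&: B|%:R - y D)) => [|D _].
    by rewrite sumrB yt; ring.
  by rewrite /g mulrBr mulr1.
have /andP [/eqP sf /eqP sg] :
    (\sum_(e in B) f e == 0) && (\sum_(D in members C) g D == 0).
  by rewrite -paddr_eq0 ?sumr_ge0 // fg.
split=> [e eB|D].
  by apply/esym/eqP; rewrite -subr_eq0; apply/eqP; apply: (psumr_eq0P f0 sf).
rewrite inE => /andP [CD yD]; have /eqP := psumr_eq0P g0 sg CD.
by rewrite mulf_eq0 (negPf yD) subr_eq0 /= pnatr_eq1 => /eqP.
Qed.

(** Otherwise one unit of [D] could be packed integrally: after lowering [w] by 1
    on [D], removing one unit of [D] from [y] shows that every cover still has weight at
    least [t - 1], so [t - 1] members can be packed, and [D] makes [t]. *)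
Lemma weight_lt1 y D : optimal_fractional y -> D \in members C -> y D < 1.
Proof.
move=> yopt CD; have [y0 yw yt] := yopt; rewrite ltNge; apply/negP => yD1.
have /subsetP DE := members_sub CD.
have [e De] : exists e, e \in D.
  by apply/set0Pn; apply: contraTneq CD => ->; apply: gap_set0.
pose v f := (w f - (f \in D))%N.
have vE f : f \in ground C -> (v f + (f \in D) = w f)%N.
  by move=> Ef; rewrite subnK //; case: (f \in D) => //; apply: w_gt0.
have lev : {in ground C, forall f, (v f <= w f)%N} by move=> f _; apply: leq_subr.
have [|C0|[B [s [cB [sC vs] leBs]]]] := below_balanced lev.
- rewrite (bigD1 e) ?DE // [ltnRHS](bigD1 e) ?DE //= /v De -addSn leq_add //.
    by rewrite subn1 prednK ?w_gt0 ?DE.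
  by apply: leq_sum => f _; apply: leq_subr.
- by have := gap_set0; rewrite C0.
have ws : packing_list C w (D :: s).
  split=> [A|f Ef]; first by rewrite inE => /predU1P [->|/sC].
  by rewrite /load /= addnC -(vE f Ef) leq_add2r vs.
have [B0 cB0 wB0] := t_attained.
have := gap_packing cB0 ws; rewrite wB0 /= ltnNge => /negP; apply.
have sumv : (\sum_(f in B) w f = \sum_(f in B) v f + #|D :&: B|)%N.
  rewrite (eq_bigr (fun f => v f + (f \in D)))%N => [|f /(subsetP cB.1) /vE //].
  rewrite big_split -sum1_card /=; congr (_ + _)%N; rewrite big_mkcond.
  rewrite [RHS]big_mkcond; apply: eq_bigr => f _; rewrite inE andbC.
  by case: (f \in B); case: (f \in D).
rewrite -(ler_nat R) -addn1; apply: (@le_trans _ _ (\sum_(f in B) v f + 1)%N%:R).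
  have BD A : A \in members C -> 1 <= #|A :&: B|%:R :> R.
    by move=> CA; rewrite ler1n card_gt0 setIC cB.2.
  have : t%:R + #|D :&: B|%:R - 1 <= (\sum_(f in B) w f)%N%:R :> R.
    apply: (@le_trans _ _ (\sum_(e in B) \sum_(A in members C | e \in A) y A)).
      rewrite sum_cover_load // -yt !(bigD1 D CD) /=.
      have : \sum_(A in members C | A != D) y A <=
             \sum_(A in members C | A != D) y A * #|A :&: B|%:R.
        apply: ler_sum => A /andP [CA _]; by rewrite ler_peMr ?y0 ?BD.
      have := BD D CD; nra.
    rewrite natr_sum; apply: ler_sum => f /(subsetP cB.1); exact: yw.
  rewrite sumv !natrD; lra.
by rewrite ler_nat leq_add2r.
Qed.

(** A linear relation [b] between the members of the support preserves the loads.
    It also preserves the total: each member of the support meets a minimum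
    cover exactly once, so the sum of [b] is the sum of its loads on that cover,
    which are 0. Subtract the largest multiple of [b] that keeps [y]
    nonnegative. *)
Lemma support_reduction y : optimal_fractional y -> ~ indep R (ground C) (supp y) ->
  exists2 y', optimal_fractional y' & (#|supp y'| < #|supp y|)%N.
Proof.
move=> yopt /dependentP [c c0 [D1 sD1 cD1]].
have {cD1} [b b0 bD1] : exists2 b : {set T} -> R,
    forall e, e \in ground C -> \sum_(D in supp y | e \in D) b D = 0 & 0 < b D1.
  have [cD|cD|cD] := ltgtP 0 (c D1); first by exists c.
    exists (fun D => - c D) => [e Ee|]; last by rewrite oppr_gt0.
    by rewrite sumrN c0 ?oppr0.
  by rewrite -cD eqxx in cD1.
have [y0 yw yt] := yopt.
have [B0 cB0 wB0] := t_attained.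
have minB0 : B0 \in min_covers by apply/min_coversP.
have [_ suppB0] := complementary_slackness yopt minB0.
have sumb : \sum_(D in supp y) b D = 0.
  transitivity (\sum_(e in B0) \sum_(D in supp y | e \in D) b D); last first.
    by rewrite big1 // => e /(subsetP cB0.1); apply: b0.
  rewrite (exchange_big_dep (mem (supp y))) /=; last by move=> e D _ /andP [].
  apply: eq_bigr => D sD; rewrite sumr_const -[LHS]mulr1n; congr (_ *+ _).
  rewrite -(suppB0 D sD); apply: eq_card => e.
  by rewrite [LHS]inE -[RHS]/((e \in B0) && ((D \in supp y) && (e \in D))) sD andbC.
pose P D := (D \in supp y) && (0 < b D).
have P1 : P D1 by rewrite /P sD1.
case: (Order.TotalTheory.arg_minP (fun D => y D / b D) P1) => D2 /andP [sD2 bD2] minD2.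
pose q := y D2 / b D2.
have y2 : 0 < y D2.
  by move: sD2; rewrite inE lt_neqAle eq_sym => /andP [CD ->]; rewrite y0.
have q0 : 0 <= q by rewrite divr_ge0 ?ltW.
pose y' D := if D \in supp y then y D - q * b D else y D.
have sum_y' (a : pred {set T}) : \sum_(D in members C | a D) y' D
    = \sum_(D in members C | a D) y D - q * \sum_(D in supp y | a D) b D.
  rewrite mulr_sumr [X in _ = _ - X](_ : _ =
      \sum_(D in members C | a D) if D \in supp y then q * b D else 0).
    rewrite -sumrB; apply: eq_bigr => D _; rewrite /y'.
    by case: ifP => //; rewrite subr0.
  rewrite -big_mkcondr /=; apply: eq_bigl => D; rewrite inE.
  by case: (D \in members C); rewrite ?andbF ?andbT //= andbC.
exists y'.
  split=> [D CD|e Ee|].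
  - rewrite /y'; case: ifP => [sD|_]; last exact: y0.
    rewrite subr_ge0; have [bD|bD] := leP (b D) 0.
      by apply: le_trans (y0 D CD); rewrite mulr_ge0_le0.
    by rewrite -ler_pdivlMr //; apply: minD2; rewrite /P sD.
  - by rewrite sum_y' b0 // mulr0 subr0 yw.
  - have := sum_y' predT; rewrite [X in _ * X](eq_bigl (mem (supp y))) => [|D].
      rewrite sumb mulr0 subr0 (eq_bigl (mem (members C))) => [->|D].
        by rewrite -yt; apply: eq_bigl => D; rewrite andbT.
      by rewrite andbT.
    by rewrite andbT.
apply: proper_card; apply/properP; split.
  apply/subsetP => D; rewrite !inE => /andP [CD]; rewrite CD /y'.
  by case: ifP => //; rewrite inE CD.
exists D2 => //; rewrite inE /y' sD2 divfK ?subrr ?eqxx ?andbF //.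
by rewrite gt_eqF.
Qed.

Lemma independent_optimum : exists2 y, optimal_fractional y &
  indep R (ground C) (supp y).
Proof.
have [y0 yopt0] : exists y, optimal_fractional y.
  by have [y ?] := fractional_packing roundC t_min; exists y.
have [k] := ubnP #|supp y0|; elim: k y0 yopt0 => // k IHk y yopt ltk.
have [iy|/(support_reduction yopt) [y' y'opt lty]] := EM (indep R (ground C) (supp y)).
  by exists y.
by apply: (IHk y') => //; apply: leq_trans lty _; rewrite -ltnS.
Qed.

(** Each support member contains exactly one element of [B]. An element [e] of [B]
    is in more than [w e] support members, since their weights sum to [w e > 0]
    and are smaller than 1. *)
Lemma min_cover_support y B : optimal_fractional y -> B \in min_covers ->
  (t + #|B| <= #|supp y|)%N.
Proof.
move=> yopt minB; have [_ wB] := min_coversP _ minB.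
have [yB suppB] := complementary_slackness yopt minB.
pose s := enum (supp y).
have -> : (#|supp y| = \sum_(e in B) load s e)%N.
  rewrite sum_load big_enum /= -sum1_card; apply: eq_bigr => D /suppB <-.
  by rewrite setIC.
rewrite -wB -sum1_card -big_split /=; apply: leq_sum => e eB; rewrite addn1.
have [y0 _ _] := yopt.
have loadE : (load s e)%:R = \sum_(D in supp y | e \in D) 1 :> R.
  by rewrite -big_enum_cond /= /load -sum1_count natr_sum.
have sumE : \sum_(D in members C | e \in D) y D = \sum_(D in supp y | e \in D) y D.
  rewrite [LHS]big_mkcond [RHS]big_mkcond; apply: eq_bigr => D _ /=.
  by rewrite inE; case: (D \in members C) => //=; case: eqP => //= ->; case: ifP.
have Ee : e \in ground C by have [[BC _] _] := min_coversP _ minB; apply: (subsetP BC).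
rewrite -(ltr_nat R) loadE -yB // sumE.
have [D /andP [sD eD]] : exists D, (D \in supp y) && (e \in D).
  apply/existsP; apply: contraT; rewrite negb_exists => /forallP nD.
  have := w_gt0 Ee; rewrite -(ltr_nat R) -yB // sumE big1 ?ltxx // => D /idPn.
  by rewrite nD.
have lt1 D' : D' \in supp y -> y D' < 1.
  by rewrite inE => /andP [CD' _]; apply: weight_lt1.
rewrite (bigD1 D) ?sD //= [ltRHS](bigD1 D) ?sD //= ltr_leD ?lt1 //.
by apply: ler_sum => D' /andP [/andP [sD' _] _]; rewrite ltW ?lt1.
Qed.

(** Let [W] be the total weight, [n] the size of the ground set, [k] that of
    the support of an independent optimum and [r] that of a basis [Q] of the minimum
    covers. Minimum covers meet support members once, so [k + r <= n + 1] by
    [indep_cross]. Every element is in a minimum cover, hence in a member of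
    [Q], so the sum of [t + #|B|] over [Q], which is at most [r * k], is at least
    [W + n]; it is also at least [W + 2 * r], as minimum covers have at least two
    elements. *)
Lemma gap_weight_bound :
  (0 < #|ground C|)%N /\
  (4 * \sum_(e in ground C) w e < (#|ground C| - 1) ^ 2)%N.
Proof.
have [y yopt indy] := independent_optimum.
have [Q [minQ indQ spanQ]] := indep_basis R (ground C) min_covers.
have {}minQ B : B \in Q -> B \in min_covers by apply: (subsetP minQ).
have coverQ e : e \in ground C -> exists2 B, B \in Q & e \in B.
  move=> Ee; have [B minB eB] := in_min_cover Ee.
  have [u uB] := spanQ B minB; apply: contrapT => nQ.
  have /eqP := uB e Ee; rewrite eB big1 ?oner_eq0 // => A /andP [QA eA].
  by case: nQ; exists A.
have sum_le (f : T -> nat) :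
    (\sum_(e in ground C) f e <= \sum_(B in Q) \sum_(e in B) f e)%N.
  rewrite (exchange_big_dep predT) //= big_mkcond; apply: leq_sum => e _.
  case: ifP => // /coverQ [B QB eB].
  by rewrite (bigD1 B) ?QB ?eB //= leq_addr.
have sumQ (B : {set T}) : B \in Q -> (\sum_(e in B) (w e + 1) = t + #|B|)%N.
  by move=> /minQ /min_coversP [_ wB]; rewrite big_split /= wB sum1_card.
have leQ : (\sum_(B in Q) (t + #|B|) <= #|Q| * #|supp y|)%N.
  rewrite -sum_nat_const; apply: leq_sum => B /minQ; exact: min_cover_support.
have n0 : (0 < #|ground C|)%N.
  have [B0 cB0 wB0] := t_attained.
  have /min_cover_card : B0 \in min_covers by apply/min_coversP.
  by move=> /ltnW /leq_trans; apply; apply/subset_leq_card/cB0.1.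
split=> //; apply: (lt_quarter_square (r := #|Q|) (k := #|supp y|)) => //.
- apply: leq_trans leQ; rewrite -(eq_bigr _ sumQ); apply: leq_trans (sum_le _).
  by rewrite big_split /= sum1_card.
- apply: leq_trans leQ; rewrite big_split /=; apply: leq_add.
    apply: leq_trans (sum_le _) _; apply: leq_sum => B /minQ /min_coversP [_ ->].
    by [].
  rewrite mulnC -sum_nat_const; apply: leq_sum => B /minQ; exact: min_cover_card.
- apply: (indep_cross (v := fun=> 1%N) indy indQ) => [D|D B sD /minQ minB].
    by rewrite inE => /andP [/members_sub].
  by have [_ ->] := complementary_slackness yopt minB.
Qed.

End MinimalGap.

(** * Replication *)

Section Replication.

Variables (T : finType) (C : clutter T) (w : T -> nat).
Hypothesis w_gt0 : forall e, 0 < w e.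

Definition copy := {e : T & 'I_(w e)}.
Implicit Types (M I J : {set copy}) (X B : {set T}) (g : T -> copy).

Definition rep_ground : {set copy} := [set u | tag u \in ground C].

(** Equality of the two cardinals expresses that [tag] is injective on [M], so
    that [M] has one copy of each element of a member of [C]. *)
Definition rep_members : {set {set copy}} :=
  [set M : {set copy} | (tag @: M \in members C) && (#|tag @: M| == #|M|)].

Lemma rep_members_sub M : M \in rep_members -> M \subset rep_ground.
Proof.
rewrite inE => /andP [/members_sub /subsetP sM _]; apply/subsetP => u uM.
by rewrite inE sM // imset_f.
Qed.

Lemma rep_members_antichain M M' :
  M \in rep_members -> M' \in rep_members -> M \subset M' -> M = M'.
Proof.
rewrite !inE => /andP [CM /eqP cM] /andP [CM' /eqP cM'] sMM'.
apply/eqP; rewrite eqEcard sMM' -cM -cM' /=.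
by rewrite (members_antichain CM CM' (imsetS _ sMM')).
Qed.

Definition replication : clutter copy :=
  Clutter rep_members_sub rep_members_antichain.

Lemma rep_tag M : M \in members replication -> tag @: M \in members C.
Proof. by rewrite inE => /andP []. Qed.

Lemma tag_section g X : {in X, forall e, tag (g e) = e} -> tag @: (g @: X) = X.
Proof.
move=> gX; rewrite -imset_comp -[RHS]imset_id.
by apply: eq_in_imset => e /gX.
Qed.

Lemma rep_section g X : {in X, forall e, tag (g e) = e} -> X \in members C ->
  g @: X \in members replication.
Proof.
move=> gX CX; rewrite inE tag_section // CX card_in_imset ?eqxx //.
by move=> e f /gX {2}<- /gX {2}<- ->.
Qed.

Definition first_copy e : copy := Tagged (fun e => 'I_(w e)) (Ordinal (w_gt0 e)).

Definition copy_such_that (P : pred copy) e : copy :=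
  odflt (first_copy e) [pick u | (tag u == e) && P u].

Lemma copy_such_thatP (P : pred copy) e u : tag u = e -> P u ->
  tag (copy_such_that P e) = e /\ P (copy_such_that P e).
Proof.
move=> ue Pu; rewrite /copy_such_that; case: pickP => [v /andP [/eqP]//|/(_ u)].
by rewrite ue eqxx Pu.
Qed.

Lemma card_copies e : #|[set u : copy | tag u == e]| = w e.
Proof.
pose f (i : 'I_(w e)) : copy := Tagged (fun e => 'I_(w e)) i.
have -> : [set u : copy | tag u == e] = f @: 'I_(w e).
  apply/setP => u; rewrite inE; apply/eqP/imsetP => [|[j _ ->] //].
  by case: u => e' i /= eqe; subst e'; exists i.
rewrite card_imset ?card_ord // => i j /eqP.
by rewrite eq_Tagged => /eqP.
Qed.

Lemma sum_copies (V : nmodType) (B : {set T}) (P : pred copy) (F : copy -> V) :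
  (\sum_(u | (tag u \in B) && P u) F u
   = \sum_(e in B) \sum_(u | (tag u == e) && P u) F u)%R.
Proof.
rewrite (partition_big (fun u : copy => tag u) (mem B)) => [|u /andP []//].
apply: eq_bigr => e; rewrite -[mem B e]/(e \in B) => Be; apply: eq_bigl => u.
by case: eqP => [->|]; rewrite ?andbF // Be andbT.
Qed.

Lemma sum_copies_weight (B : {set T}) (P : pred copy) :
  \sum_(u in [set u | (tag u \in B) && P u]) 1
  = \sum_(e in B) #|[set u | (tag u == e) && P u]|.
Proof.
under eq_bigl do rewrite inE.
transitivity (\sum_(e in B) \sum_(u | (tag u == e) && P u) 1)%N.
  exact: (@sum_copies nat).
by apply: eq_bigr => e _; rewrite -sum1_card; apply: eq_bigl => u; rewrite inE.
Qed.

Lemma card_lift B : #|[set u : copy | tag u \in B]| = \sum_(e in B) w e.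
Proof.
rewrite -sum1_card.
transitivity (\sum_(e in B) #|[set u : copy | (tag u == e) && true]|).
  by rewrite -(sum_copies_weight B predT); apply: eq_bigl => u; rewrite !inE andbT.
apply: eq_bigr => e _; rewrite -card_copies; apply: eq_card => u.
by rewrite !inE andbT.
Qed.

Lemma rep_cover B : is_cover C B -> is_cover replication [set u | tag u \in B].
Proof.
move=> [BC cB]; split=> [|M /rep_tag /cB /set0Pn [e]].
  by apply/subsetP => u; rewrite !inE; apply: (subsetP BC).
rewrite inE => /andP [eB /imsetP [u uM eqe]].
by apply/set0Pn; exists u; rewrite !inE uM -eqe eB.
Qed.

(** Keep the elements all of whose copies are in [B']. If a member of [C] had none
    of them, choosing for each of its elements a copy outside [B'] would give a
    member of the replication missed by [B']. *)
Lemma cover_of_rep (B' : {set copy}) : is_cover replication B' ->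
  exists2 B, is_cover C B & \sum_(e in B) w e <= #|B'|.
Proof.
move=> [B'C cB'].
pose B := [set e in ground C | [forall u : copy, (tag u == e) ==> (u \in B')]].
exists B.
  split=> [|X CX]; first by apply/subsetP => e; rewrite inE => /andP [].
  apply/negP => /eqP BX; pose g := copy_such_that (fun u => u \notin B').
  have gX e : e \in X -> tag (g e) = e /\ g e \notin B'.
    move=> eX; have : e \notin B.
      by apply/negP => eB; have := in_set0 e; rewrite -BX in_setI eB eX.
    rewrite inE (subsetP (members_sub CX)) //= => /forallPn [u].
    by rewrite negb_imply => /andP [/eqP ue uB']; apply: copy_such_thatP ue uB'.
  have /cB' /set0Pn [u] : g @: X \in members replication.
    by apply: rep_section => // e /gX [].
  rewrite inE => /andP [uB' /imsetP [e /gX [_ /negPf ge] eqe]].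
  by rewrite eqe ge in uB'.
rewrite -card_lift.
apply/subset_leq_card/subsetP => u; rewrite !inE => /andP [_ /forallP /(_ u)].
by rewrite eqxx.
Qed.

Lemma balanced_of_replication : balanced replication (fun=> 1) -> balanced C w.
Proof.
case=> [|[B' [s [cB' [sC ws] leBs]]]].
  by rewrite inE imset0 => /andP [C0 _]; left.
have [B cB leB] := cover_of_rep cB'; right.
exists B, [seq tag @: (M : {set copy}) | M <- s]; split=> //; last first.
  by rewrite size_map (leq_trans leB) // -sum1_card.
split=> [X /mapP [M /sC /rep_tag CM ->] //|e Ee].
rewrite -card_copies -sum1_card.
apply: leq_trans (_ : \sum_(u in [set u : copy | tag u == e]) load s u <= _).
  rewrite {ws leBs sC} sum_load; elim: s => [|M s IHs]; first by rewrite big_nil.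
  rewrite big_cons /load /=; apply: leq_add IHs; case: imsetP => // -[u uM ->].
  by rewrite card_gt0; apply/set0Pn; exists u; rewrite !inE eqxx.
by apply: leq_sum => u; rewrite inE => /eqP ue; apply: ws; rewrite inE ue.
Qed.

(** Reading a fractional cover [x] at the copy of smallest value gives a
    fractional cover of [C]; its cost does not increase when an element of [C] is
    charged the sum of the weights of its copies, which is also the cost of
    lifting a cover of [C]. *)
Lemma replication_roundable (R : realType) : roundable R C -> roundable R replication.
Proof.
move=> rC v x [x1 x0].
have cheapest e : exists u : copy, tag u = e /\
    forall u', tag u' = e -> (x u <= x u')%R.
  have P0 : tag (first_copy e) == e by [].
  case: (Order.TotalTheory.arg_minP (P := fun u => tag u == e) x P0) => u /eqP ue minu.
  by exists u; split=> // u' /eqP; apply: minu.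
have [g gP] := choice cheapest.
pose W e := \sum_(u | (tag u == e) && true) v u.
have [|B cB leB] := rC W (fun e => x (g e)).
  split=> [X CX|e Ee]; last by apply: x0; rewrite inE (gP e).1.
  rewrite -(big_imset (fun u => x u)) /=.
    by apply: x1; apply: rep_section CX => e _; apply: (gP e).1.
  by move=> e f _ _ eqg; rewrite -(gP e).1 eqg (gP f).1.
exists [set u | tag u \in B]; first exact: rep_cover.
have -> : \sum_(u in [set u | tag u \in B]) v u = \sum_(e in B) W e.
  rewrite -(@sum_copies nat); apply: eq_bigl => u; by rewrite inE andbT.
apply: le_trans leB _; rewrite /lp_value.
rewrite [leRHS](eq_bigl (fun u : copy => (tag u \in ground C) && true)); last first.
  by move=> u; rewrite inE andbT.
rewrite sum_copies; apply: ler_sum => e _.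
rewrite /W natr_sum mulr_suml; apply: ler_sum => u /andP [/eqP ue _].
by rewrite ler_wpM2l ?ler0n // (gP e).2.
Qed.

(** Greedy choice: serve the listed sets one after the other, giving to each an
    available copy of each of its elements and adding these copies to [I].
    Elements with a copy in [J] use that copy, which can be shared, since [J] is
    removed afterwards. *)
Lemma allocate_copies (J : {set copy}) (s : seq {set T}) I : [disjoint I & J] ->
  (forall X, X \in s -> exists2 X', X' \in members C & X = X' :\: tag @: J) ->
  (forall e, load s e <= #|[set u : copy | (tag u == e) && (u \notin I)]|) ->
  exists s1 : seq {set copy}, [/\ size s1 = size s,
    forall M, M \in s1 -> exists M', [/\ M' \in members replication,
      [disjoint M' & I] & M = M' :\: J] &
    forall u, load s1 u <= 1].
Proof.
elim: s I => [|X s IHs] I dIJ sC ws; first by exists [::].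
have [X' CX' eqX] := sC X (mem_head _ _).
pose g e := if e \in tag @: J then copy_such_that (fun u => u \in J) e
            else copy_such_that (fun u => u \notin I) e.
have gJ e : e \in tag @: J -> tag (g e) = e /\ g e \in J.
  move=> Je; rewrite /g Je; have /imsetP [u uJ eqe] := Je.
  exact: (copy_such_thatP (esym eqe) uJ).
have gX e : e \in X -> tag (g e) = e /\ g e \notin I.
  move=> Xe; have := Xe; rewrite eqX inE => /andP [/negPf Je _].
  have : 0 < #|[set u : copy | (tag u == e) && (u \notin I)]|.
    by apply: leq_trans (ws e); rewrite /load /= Xe.
  case/card_gt0P=> u; rewrite inE => /andP [/eqP ue uI]; rewrite /g Je.
  exact: (copy_such_thatP ue uI).
have gX' e : e \in X' -> tag (g e) = e /\ g e \notin I.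
  move=> X'e; have [Je|Je] := boolP (e \in tag @: J); last first.
    by apply: gX; rewrite eqX inE Je.
  by have [-> gej] := gJ e Je; split=> //; rewrite (disjointFl dIJ gej).
have DM : g @: X' \in members replication by apply: rep_section CX' => e /gX' [].
have [M eqM] : exists M, M = (g @: X') :\: J by eexists.
have MX u : u \in M -> tag u \in X /\ u = g (tag u).
  rewrite eqM inE => /andP [uJ /imsetP [e X'e eqe]]; have [ge _] := gX' e X'e.
  rewrite eqe ge; split=> //; rewrite eqX inE X'e andbT.
  by apply: contra uJ => /gJ [_]; rewrite -eqe.
have dMI : [disjoint g @: X' & I].
  rewrite disjoint_subset; apply/subsetP => u /imsetP [e /gX' [_ geI] ->].
  by rewrite inE.
have [||| s1 [size1 s1D s1u]] := IHs (I :|: M).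
- rewrite -setI_eq0 setIUl setU_eq0 setI_eq0 dIJ /= eqM.
  by apply/eqP/setP => u; rewrite !inE; case: (u \in J); rewrite ?andbF.
- by move=> Y sY; apply: sC; rewrite inE sY orbT.
- move=> e; have := ws e; rewrite /load /=.
  set F := [set u | _ & _]; set F' := [set u | _ & _] => leF.
  have leFF : #|F :\: F'| <= (e \in X).
    have [eX|eX] := boolP (e \in X).
      apply: (@leq_trans #|[set g e]|); last by rewrite cards1.
      apply/subset_leq_card/subsetP => u.
      rewrite !inE negb_and => /andP [+ /andP [/eqP ue uI]].
      by rewrite ue eqxx negb_or uI /= negbK => /MX [_ ->]; rewrite ue.
    rewrite /= leqn0 cards_eq0; apply/eqP/setP => u; rewrite !inE.
    apply/negP => /andP [+ /andP [/eqP ue uI]].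
    by rewrite negb_and ue eqxx negb_or uI /= negbK => /MX [uX _]; rewrite -ue uX in eX.
  have leF' : #|F| <= #|F'| + #|F :\: F'|.
    by rewrite -(cardsID F') leq_add2r subset_leq_card // subsetIr.
  rewrite -(leq_add2l (e \in X)); apply: leq_trans leF (leq_trans leF' _).
  by rewrite addnC leq_add2r.
exists (M :: s1); split=> [|M1|u]; first by rewrite /= size1.
  rewrite inE => /predU1P [->|/s1D [M' [DM' dM' ->]]]; first by exists (g @: X').
  exists M'; split=> //; apply: disjointWr dM'; exact: subsetUl.
rewrite /load /=; have [uM|uM] := boolP (u \in M); last exact: s1u.
rewrite -[leqRHS]addn0 leq_add2l leqn0 -[_ == _]negbK -lt0n -has_count.
apply/hasPn => M1 /s1D [M' [_ dM' ->]]; rewrite inE negb_and; apply/orP; right.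
by rewrite (disjointFl dM') // inE uM orbT.
Qed.

(** A minor of the replication behaves like a replication of a minor of [C]: an
    element with a contracted copy counts as contracted, and the other elements
    keep the copies that are not deleted. *)
Lemma replication_minor_balanced I J : minor_sets replication I J ->
  balanced (minor C set0 (tag @: J))
    (fun e => #|[set u : copy | (tag u == e) && (u \notin I)]|) ->
  balanced (minor replication I J) (fun=> 1).
Proof.
move=> [IC JC dIJ]; set v := fun e => #|_|.
case=> [/minor_lift [X [CX _ /esym/eqP]]|[B [s [cB [sC vs] leBs]]]].
  rewrite setD_eq0 => /subsetP XJ; left.
  pose g := copy_such_that (fun u => u \in J).
  have gX e : e \in X -> tag (g e) = e /\ g e \in J.
    by move=> /XJ /imsetP [u uJ ->]; apply: copy_such_thatP uJ.
  have DM : g @: X \in members replication by apply: rep_section CX => e /gX [].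
  have MJ : g @: X \subset J by apply/subsetP => u /imsetP [e /gX [_ ?] ->].
  have dMI : [disjoint g @: X & I] by rewrite disjoint_sym (disjointWr MJ).
  have [M mM] := minor_shrink J DM dMI.
  rewrite (_ : _ :\: J = set0); last by apply/eqP; rewrite setD_eq0.
  by rewrite subset0 => /eqP <-.
have [BE cB0] := (is_cover_minor _ _ _ _).1 cB.
have [||s1 [size1 s1D s1u]] := allocate_copies (s := s) dIJ.
- by move=> X /sC /minor_lift [X' [CX' _ ->]]; exists X'.
- move=> e; have [Ee|Ee] := boolP (e \in ground (minor C set0 (tag @: J))).
    exact: vs.
  rewrite /load (_ : count _ s = 0) //; apply/eqP; rewrite -leqn0 leqNgt -has_count.
  by apply/hasPn => X /sC /members_sub /subsetP sX; apply: contra Ee => /sX.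
have shrink1 M : exists M', M \in s1 ->
    M' \in members (minor replication I J) /\ M' \subset M.
  have [sM|nsM] := boolP (M \in s1); last by exists set0.
  have [M0 [DM0 dM0 ->]] := s1D M sM.
  by have [M' mM' sM'] := minor_shrink J DM0 dM0; exists M'.
have [h hP] := choice shrink1; right.
exists [set u : copy | (tag u \in B) && (u \notin I)], [seq h M | M <- s1]; split.
- apply/is_cover_minor; split=> [|M /rep_tag CM dMI].
    apply/subsetP => u; rewrite !inE => /andP [/(subsetP BE)].
    rewrite !inE => /andP [tJ ->] /negPf ->; rewrite andbT /=.
    by apply: contra tJ => uJ; rewrite imset_f.
  have d0 : [disjoint tag @: M & set0] by rewrite -setI_eq0 setI0.
  have /set0Pn [e] := cB0 _ CM d0; rewrite inE => /andP [eB /imsetP [u uM eqe]].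
  by apply/set0Pn; exists u; rewrite !inE -eqe eB uM (disjointFr dMI uM).
- split=> [M' /mapP [M sM ->]|u _]; first by have [] := hP M sM.
  apply: leq_trans (s1u u); rewrite /load count_map -!sum1_count big_mkcond.
  rewrite [leqRHS]big_mkcond big_seq [leqRHS]big_seq; apply: leq_sum => M sM /=.
  by have [_ /subsetP hM] := hP M sM; case: ifP => // /hM ->.
- by rewrite sum_copies_weight size_map size1.
Qed.

End Replication.

(** * Minimal counterexamples *)

Section MinimalCounterexample.

Variables (T : finType) (C : clutter T).
Implicit Types (w v : T -> nat).

Lemma members_minor00 : members (minor C set0 set0) = members C.
Proof.
apply/setP => D; apply/idP/idP => [/minor_lift [D' [CD' _ ->]]|CD].
  by rewrite setD0.
by apply: deletion_members; rewrite // -setI_eq0 setI0.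
Qed.

Lemma minor00_balanced w : balanced (minor C set0 set0) w <-> balanced C w.
Proof.
have E00 : ground (minor C set0 set0) = ground C by rewrite /= setU0 setD0.
split; first exact: (balanced_ext E00 members_minor00).
exact: (balanced_ext (esym E00) (esym members_minor00)).
Qed.

(** An element of weight 0 can be deleted: it is free in covers and useless in
    packings. *)
Lemma balanced_zero w e : e \in ground C -> w e = 0 ->
  balanced (minor C [set e] set0) w -> balanced C w.
Proof.
move=> Ee we0 [/minor_lift [D [CD _ D0]]|[B [s [cB [sC ws] leBs]]]].
  by left; rewrite D0 setD0.
have [BE cB0] := (is_cover_minor _ _ _ _).1 cB; right.
have lift D : D \in s -> D \in members C /\ e \notin D.
  move=> /sC /minor_lift [D' [CD' dD' ->]]; rewrite setD0; split=> //.
  by rewrite -disjoints1 disjoint_sym.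
exists (e |: B), s; split.
- split=> [|D CD].
    by rewrite subUset sub1set Ee (subset_trans BE) // subsetDl.
  have [eD|eD] := boolP (e \in D).
    by apply/set0Pn; exists e; rewrite !inE eqxx eD.
  have /set0Pn [f] : B :&: D != set0.
    by apply: cB0; rewrite // disjoint_sym disjoints1.
  by rewrite inE => /andP [fB fD]; apply/set0Pn; exists f; rewrite !inE fB fD orbT.
- split=> [D /lift [] //|f Ef]; have [->|nfe] := eqVneq f e.
    rewrite we0 leqn0 -[_ == _]negbK -lt0n -has_count.
    by apply/hasPn => D /lift [].
  by apply: ws; rewrite /= !inE (negPf nfe) Ef.
rewrite big_setU1 ?we0 //.
by apply/negP => /(subsetP BE); rewrite !inE eqxx.
Qed.

(** All members contain [e], so contracting [e] relaxes only the capacity of [e],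
    which bounds the length of a packing by [w e]. Either the packing of the
    contraction respects that bound, or its truncation has the weight of the cover
    [[set e]]. *)
Lemma balanced_singleton w e : is_cover C [set e] ->
  balanced (minor C set0 [set e]) w -> balanced C w.
Proof.
move=> ce; have [/= + eC] := ce; rewrite sub1set => Ee.
have eD D : D \in members C -> e \in D.
  by move=> /eC /set0Pn [f]; rewrite !inE => /andP [/eqP ->].
case=> [/minor_lift [D [CD _ /esym/eqP]]|[B [s [cB [sC ws] leBs]]]].
  rewrite setD_eq0 => De; have eqD : D = [set e].
    by apply/eqP; rewrite eqEsubset De sub1set eD.
  right; exists [set e], (nseq (w e) D); split=> //.
    split=> [A|f _]; first by rewrite mem_nseq => /andP [_ /eqP ->].
    by rewrite /load count_nseq eqD inE; case: eqP => [->|]; rewrite ?mul1n.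
  by rewrite big_set1 size_nseq.
have [BE cB0] := (is_cover_minor _ _ _ _).1 cB.
have cB' : is_cover C B.
  split=> [|D CD]; first by rewrite (subset_trans BE) // subsetDl.
  by apply: cB0; rewrite // -setI_eq0 setI0.
pose s' := take (w e) [seq e |: D | D <- s].
have ws' : packing_list C w s'.
  split=> [D /mem_take /mapP [D1 /sC /minor_lift [D' [CD' _ ->]] ->]|f Ef].
    by rewrite setD1K ?eD.
  have [->|nfe] := eqVneq f e.
    by apply: leq_trans (count_size _ _) _; rewrite size_take; case: ltnP.
  apply: leq_trans (ws f _); last by rewrite /= !inE (negPf nfe) Ef.
  have -> : load s f = load [seq e |: (D : {set T}) | D <- s] f.
    by rewrite /load count_map; apply: eq_count => D; rewrite /= !inE (negPf nfe).
  rewrite /load -[in leqRHS](cat_take_drop (w e) [seq _ | D <- s]) count_cat.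
  exact: leq_addr.
right; have [lt_we|le_s] := ltnP (w e) (size s).
  by exists [set e], s'; rewrite big_set1 size_take size_map lt_we.
by exists B, s'; rewrite size_take size_map ltnNge le_s.
Qed.

Lemma minimal_gap w : ~ balanced C w -> exists2 w', ~ balanced C w' &
  forall v, \sum_(e in ground C) v e < \sum_(e in ground C) w' e -> balanced C v.
Proof.
move=> gap.
pose P k := `[< exists2 w', ~ balanced C w' & \sum_(e in ground C) w' e = k >].
have exP : exists k, P k.
  by exists (\sum_(e in ground C) w e); apply/asboolP; exists w.
case: (ex_minnP exP) => k /asboolP [w' gap' <-] mink.
exists w' => // v ltv; apply: contrapT => gapv.
move: ltv; rewrite ltnNge => /negP; apply.
by apply: mink; apply/asboolP; exists v.
Qed.

End MinimalCounterexample.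

Local Open Scope ring_scope.

Theorem theorem2 (R : realType) (n : nat) (hn : (2 <= n)%N)
    (tau2 : forall (S : finType) (D : clutter S),
      ideal R D -> minimally_nonpacking D ->
      (#|ground D|%:R : R) < (n%:R - 1) ^+ 2 / 4 ->
      covering_number D = Some 2%N)
    (T : finType) (C : clutter T) (hC : (#|ground C| <= n)%N) :
  packing_property C -> MFMC C.
Proof.
have [k] := ubnP #|ground C|; elim: k C hC => // k IHk C leCn ltk ppC.
have minor_balanced I J w : minor_sets C I J -> I :|: J != set0 ->
    balanced (minor C I J) w.
  move=> IJ IJ0; have [IE JE _] := IJ.
  have lt_minor : (#|ground C :\: (I :|: J)| < #|ground C|)%N.
    have IJE : I :|: J \subset ground C by rewrite subUset IE.
    rewrite cardsDS // ltn_subrL card_gt0 IJ0 /=.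
    by apply: leq_trans (subset_leq_card IJE); rewrite card_gt0.
  apply/tau_eq_nuP; apply: IHk (minor_packing_property IJ ppC) w => /=.
    by rewrite ltnW // (leq_trans lt_minor).
  by apply: leq_trans lt_minor _; rewrite -ltnS.
have delC e : e \in ground C -> minor_sets C [set e] set0 /\ [set e] :|: set0 != set0.
  move=> Ee; split; last by rewrite setU0; apply/set0Pn; exists e; rewrite inE.
  by split; rewrite ?sub1set ?sub0set // -setI_eq0 setI0.
have conC (J : {set T}) : J \subset ground C -> J != set0 ->
    minor_sets C set0 J /\ set0 :|: J != set0.
  move=> JE J0; rewrite set0U; split=> //.
  by split; rewrite ?sub0set // -setI_eq0 set0I.
have bal1 : balanced C (fun=> 1%N).
  apply/minor00_balanced/tau_eq_nuP/ppC.
  by split; rewrite ?sub0set // -setI_eq0 setI0.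
have con1 e : e \in ground C -> minor_sets C set0 [set e] /\ set0 :|: [set e] != set0.
  by move=> Ee; apply: conC; rewrite ?sub1set //; apply/set0Pn; exists e; rewrite inE.
have roundC : roundable R C.
  apply: roundable_of_minors bal1 => e Ee; apply: balanced_roundable => w.
    by have [? ?] := delC e Ee; apply: minor_balanced.
  by have [? ?] := con1 e Ee; apply: minor_balanced.
move=> w1; apply/tau_eq_nuP; apply: contrapT => gap1.
have [w2 gap2 below2] := minimal_gap gap1.
(* Elements outside the ground set get weight 1, so that every element of [T] has
   a copy in the replication. *)
pose w e := if e \in ground C then w2 e else 1%N.
have ww2 : {in ground C, w =1 w2} by move=> e Ee; rewrite /w Ee.
have gap : ~ balanced C w by move=> /(balanced_ext erefl erefl ww2).
have below v : (\sum_(e in ground C) v e < \sum_(e in ground C) w e)%N -> balanced C v.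
  by rewrite [ltnRHS](eq_bigr w2) //; apply: below2.
have w_gt0 e : (0 < w e)%N.
  have [Ee|Ee] := boolP (e \in ground C); last by rewrite /w (negPf Ee).
  rewrite lt0n; apply/eqP => we0; apply: gap; apply: (balanced_zero Ee we0).
  by have [? ?] := delC e Ee; apply: minor_balanced.
have no_single e : ~ is_cover C [set e].
  move=> ce; apply: gap; apply: (balanced_singleton ce).
  have [] := con1 e; last by move=> ? ?; apply: minor_balanced.
  by have [] := ce; rewrite sub1set.
have [B0 cB0 minB0] := min_cover_exists w (gap_set0 gap).
have below' v : {in ground C, forall e, v e <= w e}%N ->
    (\sum_(e in ground C) v e < \sum_(e in ground C) w e)%N -> balanced C v.
  by move=> _; apply: below.
have t_att : exists2 B, is_cover C B & (\sum_(e in B) w e = \sum_(e in B0) w e)%N.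
  by exists B0.
have w_gt0' : {in ground C, forall e, 0 < w e}%N by move=> e _; apply: w_gt0.
have [n0 bound] := gap_weight_bound roundC gap below' w_gt0' no_single t_att minB0.
pose D := replication C w.
have cardD : #|ground D| = (\sum_(e in ground C) w e)%N by rewrite -card_lift.
have idD : ideal R D by apply/roundable_ideal/replication_roundable.
have mnpD : minimally_nonpacking D.
  split=> [/tau_eq_nuP /(balanced_of_replication w_gt0) //|I J IJ IJ0].
  apply/tau_eq_nuP; apply: replication_minor_balanced => //.
  have [IE JE _] := IJ.
  have [J0|J0] := eqVneq J set0; last first.
    have [||? ?] := conC [set tag x | x in J]; last exact: minor_balanced.
    - by apply/subsetP => e /imsetP [u /(subsetP JE) + ->]; rewrite inE.
    - by rewrite imset_eq0.
  rewrite J0 imset0; apply/minor00_balanced; apply: below.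
  move: IJ0; rewrite J0 setU0 => /set0Pn [u uI].
  have Eu : tag u \in ground C by have := subsetP IE u uI; rewrite inE.
  rewrite (bigD1 (tag u)) //= [ltnRHS](bigD1 (tag u)) //= -addSn.
  apply: leq_add; last first.
    apply: leq_sum => e _; rewrite -[leqRHS]card_copies; apply: subset_leq_card.
    by apply/subsetP => u'; rewrite !inE => /andP [].
  rewrite -[leqRHS]card_copies; apply: proper_card; apply/properP; split.
    by apply/subsetP => u'; rewrite !inE => /andP [].
  by exists u; rewrite !inE eqxx ?uI.
have cov2 : covering_number D = Some 2%N.
  apply: tau2 => //; rewrite ltr_pdivlMr // cardD.
  have -> : n%:R - 1 = (n - 1)%:R :> R by rewrite natrB // ltnW.
  rewrite -natrM -natrX ltr_nat mulnC; apply: leq_trans bound _.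
  by rewrite leq_exp2r // leq_sub2r.
have [B' cB' cardB'] := minimum_in cov2.
have [B cB leB] := cover_of_rep w_gt0 cB'.
have {}leB : (\sum_(e in B0) w e <= 2)%N.
  by apply: leq_trans (minB0 B cB) (leq_trans leB _); rewrite cardB' sum1_card.
have [e Ee we] : exists2 e, e \in ground C & (1 < w e)%N.
  apply: contrapT => nw; apply: gap; apply: balanced_ext bal1 => // e Ee.
  apply/eqP; rewrite eqn_leq w_gt0 /= leqNgt; apply/negP => we; apply: nw.
  by exists e.
have [A /min_coversP [cA wA] eA] := in_min_cover gap below' w_gt0' t_att minB0 Ee.
apply: (no_single e); rewrite (_ : [set e] = A) //; apply/eqP.
rewrite eqEsubset sub1set eA /=; apply/subsetP => f fA; rewrite inE.
apply/negPn/negP => nfe; move: leB; rewrite -wA (bigD1 e) //= (bigD1 f) ?fA //=.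
by have := w_gt0 f; lia.
Qed.
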